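(* For every $v\equiv 1$ or $5\pmod{10}$ with $v\notin\{5,15,11,91\}$, there exists a super-simple $2$-$(v,5,1)$DD $\mathcal{D}$ with $f(\mathcal{D})\geq\frac12$.
   Context: A $2$-$(v,5,1)$ directed design ($2$-$(v,5,1)$DD) is a pair $(V,\mathcal{B})$ where $|V|=v$ and $\mathcal{B}$ is a collection of ordered $5$-tuples of distinct elements of $V$ (blocks) such that every ordered pair $(x,y)$ of distinct elements of $V$ occurs in exactly one block as a subsequence. It is super-simple if, after forgetting the order in blocks (giving a $2$-$(v,5,2)$-BIBD), any two blocks intersect in at most two points. A defining set of a $2$-$(v,5,1)$DD $\mathcal{D}=(V,\mathcal{B})$ is a subset $S\subseteq\mathcal{B}$ such that $\mathcal{D}$ is the unique $2$-$(v,5,1)$DD on $V$ whose block collection contains $S$. Define $f(\mathcal{D})$ as the number of blocks in a smallest defining set of $\mathcal{D}$ divided by $|\mathcal{B}|$. *)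

(* Defs.v *)
From mathcomp Require Import all_boot all_order all_algebra.

Set Implicit Arguments.
Unset Strict Implicit.
Unset Printing Implicit Defensive.

Import GRing.Theory Num.Theory.

(* A 2-(v,5,1)DD on V is given by its block collection B.  A set of tuples is
   enough: a repeated block would contain its ordered pairs more than once. *)
Definition directed_design (V : finType) (B : {set 5.-tuple V}) : bool :=
  [forall b in B, uniq b] &&
  [forall x, forall y,
     (x != y) ==> (#|[set b in B | subseq [:: x; y] b]| == 1)].

(* Distinct ordered blocks with the same support count as two blocks of the
   underlying 2-(v,5,2)-BIBD (and so violate super-simplicity). *)
Definition super_simple (V : finType) (B : {set 5.-tuple V}) : bool :=
  [forall b in B, forall c in B,
     (b != c) ==> (#|[set x in b] :&: [set x in c]| <= 2)].

Definition defining_set (V : finType) (B S : {set 5.-tuple V}) : bool :=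
  (S \subset B) &&
  [forall B' : {set 5.-tuple V},
     directed_design B' && (S \subset B') ==> (B' == B)].

(* The default value B of the arg min is itself a defining set when B is a
   directed design: see defining_set_refl. *)
Definition smallest_defining_set (V : finType) (B : {set 5.-tuple V}) :
    {set 5.-tuple V} :=
  [arg min_(S < B | defining_set B S) #|S|].

Definition f (V : finType) (B : {set 5.-tuple V}) : rat :=
  (#|smallest_defining_set B|%:R / #|B|%:R)%R.

Lemma defining_set_refl (V : finType) (B : {set 5.-tuple V}) :
  directed_design B -> defining_set B B.
Proof.
move=> /andP[_ /forallP dB]; apply/andP; split=> //.
apply/forallP=> B'; apply/implyP=> /andP[/andP[/forallP uB' /forallP dB'] sBB'].
rewrite eqEsubset sBB' andbT; apply/subsetP=> c cB'.
have uc : uniq c by move: (uB' c); rewrite cB'.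
case: (tupleP c) cB' uc => x t; case: (tupleP t) => y u cB' uc.
set c0 := [tuple of _] in cB' uc *.
have nxy : x != y by move: uc; rewrite /= inE negb_or -andbA => /andP[].
have sc : subseq [:: x; y] c0 by rewrite /= !eqxx sub0seq.
have /forallP/(_ y) := dB x; rewrite nxy /= => /cards1P[b /setP eb].
have /forallP/(_ y) := dB' x; rewrite nxy /= => /cards1P[b' /setP eb'].
have := eb b; rewrite !inE eqxx => /andP[bB sb].
have := eb' b; rewrite !inE (subsetP sBB' _ bB) sb => /esym/eqP bb'.
by have := eb' c0; rewrite !inE cB' sc => /esym/eqP ->; rewrite -bb'.
Qed.

(* Main.v *)
Require Import Defs.
From mathcomp Require Import all_boot all_order all_algebra.
From Stdlib Require BinNat.
From mathcomp Require Import zify.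

(* If the blocks of a directed design can be permuted by [pi] so that [b] and [pi b] contain the same
   two points as adjacent entries, in opposite orders, then swapping those entries in both blocks
   gives another design; hence every defining set meets [{b, pi b}] for each [b], and so contains at
   least half of the blocks.  Super-simple decompositions with such a permutation [pi] exist for a
   union of edge-disjoint graphs as soon as they exist for each of them.  Wilson's construction from
   a TD(6,n), with weight [m] on five groups and weights [w] on the last, reduces the order
   [5 m n + s + 1] to the smaller orders [m n + 1] and [s + 1] and to eleven multipartite graphs
   [m^5 w].  It leaves finitely many orders, which come from explicit designs with a cyclic
   automorphism group found by computer. *)

Set Implicit Arguments.
Unset Strict Implicit.
Unset Printing Implicit Defensive.

(** * Decompositions with trades *)

(** A permutation is asked for, and not a partition of the blocks into disjoint trades, because the
    number v(v-1)/10 of blocks may be odd: for v = 31 there are 93 blocks, and disjoint pairs would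
    force only 46 of them. Under a permutation every block occurs once as a source and once as a
    partner, so that summing over all pairs {b, pi b} counts each block of a defining set twice;
    this gives one half whatever the cycle lengths of pi. Super-simplicity is what makes the swapped
    design differ from the old one, since the altered block keeps its five points. Both properties
    survive unions: the trades of one piece do not involve the others, and blocks of edge-disjoint
    graphs share at most one point. The summand 1 in the orders is a point at infinity common to all
    groups when they are filled. For large orders the weight m = 10 is enough: five groups of order
    10 n + 1 with weights 0, 4, 10 on the last one reach both residues 1 and 5 modulo 10. The
    smaller weights serve small orders only. *)

Definition swappable (T : eqType) (b c : seq T) : bool :=
  has (fun p => infix [:: p.1; p.2] b && infix [:: p.2; p.1] c)
      [seq (x, y) | x <- b, y <- b].

(** [R] is the graph whose ordered edges are each covered once. [B'] lists the images of the blocks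
    of [B] under the permutation pi, in the same order. With lists, a union of decompositions is a
    concatenation; repeated blocks are excluded by the counts. *)
Definition decomposition (T : eqType) (R : rel T) (B B' : seq (seq T)) : Prop :=
  [/\ {in B, forall b : seq T, uniq b && (size b == 5)},
      forall x y, count (subseq [:: x; y]) B = R x y,
      {in B &, forall b c : seq T, b != c -> size [seq x <- b | x \in c] <= 2},
      perm_eq B' B & all2 (@swappable T) B B'].

Definition good (T : eqType) (R : rel T) : Prop :=
  exists B B', decomposition R B B'.

Lemma infix_mem (T : eqType) (s t : seq T) : infix s t -> {subset s <= t}.
Proof. by move=> /mem_infix. Qed.

Lemma swappableP (T : eqType) (b c : seq T) :
  reflect (exists x y, infix [:: x; y] b && infix [:: y; x] c) (swappable b c).
Proof.
apply: (iffP hasP) => [[[x y] _ h]|[x [y h]]]; first by exists x, y.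
exists (x, y) => //; have /andP[/infix_mem hb _] := h.
by apply/allpairsP; exists (x, y); rewrite !hb // !inE eqxx ?orbT.
Qed.

Lemma subseq2_mem (T : eqType) (x y : T) (b : seq T) :
  subseq [:: x; y] b -> (x \in b) && (y \in b).
Proof. by move=> /mem_subseq h; rewrite !h // !inE eqxx ?orbT. Qed.

Lemma mem2_subseq2 (T : eqType) (x y : T) (b : seq T) :
  x != y -> x \in b -> y \in b -> subseq [:: x; y] b || subseq [:: y; x] b.
Proof.
move=> xy; elim: b => //= z b IH; rewrite !inE.
case: (eqVneq x z) => [<-{z}|xz] /=.
  by rewrite eq_sym (negbTE xy) /= => _ yb; rewrite sub1seq yb.
move=> xb; case: (eqVneq y z) => [_ _|yz] /=; last exact: IH.
by rewrite sub1seq xb orbT.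
Qed.

Lemma good_eq (T : eqType) (R R' : rel T) : R =2 R' -> good R -> good R'.
Proof. by move=> e [B [B' [h1 h2 h3 h4 h5]]]; exists B, B'; split=> // x y; rewrite h2 e. Qed.

Lemma good0 (T : eqType) (R : rel T) : R =2 (fun _ _ => false) -> good R.
Proof. by move=> e; exists [::], [::]; split=> // x y; rewrite e. Qed.

Lemma decomposition_cover (T : eqType) (R : rel T) B B' b x y :
  decomposition R B B' -> b \in B -> subseq [:: x; y] b -> R x y.
Proof.
case=> _ h _ _ _ bB xyb; have := h x y; case: (R x y) => // /eqP.
by rewrite -leqn0 leqNgt -has_count => /hasP[]; exists b.
Qed.

Lemma disjoint_cover_share (T : eqType) (R1 R2 : rel T) B1 B1' B2 B2' b c :
  symmetric R1 -> symmetric R2 -> (forall x y, ~~ (R1 x y && R2 x y)) ->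
  decomposition R1 B1 B1' -> decomposition R2 B2 B2' -> b \in B1 -> c \in B2 ->
  size [seq x <- b | x \in c] <= 1.
Proof.
move=> s1 s2 d D1 D2 bB cB; rewrite leqNgt; apply/negP.
have /andP[ub _] : uniq b && (size b == 5) by case: D1 => + _ _ _ _; apply.
case e: [seq x <- b | x \in c] => [|x [|y s]] // _.
have sub : subseq [:: x; y] b.
  by apply: (subseq_trans _ (filter_subseq (mem c) b)); rewrite e /= !eqxx sub0seq.
have xy : x != y.
  by have := filter_uniq (mem c) ub; rewrite e /= inE negb_or -andbA => /andP[].
have inc z : z \in [:: x, y & s] -> z \in c by rewrite -e mem_filter => /andP[].
have xc : x \in c by apply: inc; rewrite inE eqxx.
have yc : y \in c by apply: inc; rewrite !inE eqxx orbT.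
have h1 := decomposition_cover D1 bB sub.
have h2 : R2 x y.
  case/orP: (mem2_subseq2 xy xc yc) => /(decomposition_cover D2 cB) //.
  by rewrite s2.
by have := d x y; rewrite h1 h2.
Qed.

Lemma all2_cat (S T : Type) (r : S -> T -> bool) s1 s2 t1 t2 :
  all2 r s1 t1 -> all2 r s2 t2 -> all2 r (s1 ++ s2) (t1 ++ t2).
Proof.
move=> h1 h2; elim: s1 t1 h1 => [|x s IH] [|y t] //= /andP[-> h].
exact: IH h.
Qed.

Lemma good_union (T : eqType) (R1 R2 : rel T) :
  symmetric R1 -> symmetric R2 -> (forall x y, ~~ (R1 x y && R2 x y)) ->
  good R1 -> good R2 -> good [rel x y | R1 x y || R2 x y].
Proof.
move=> s1 s2 d [B1 [B1' D1]] [B2 [B2' D2]].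
have d' x y : ~~ (R2 x y && R1 x y) by rewrite andbC.
have cross12 := disjoint_cover_share s1 s2 d D1 D2.
have cross21 := disjoint_cover_share s2 s1 d' D2 D1.
have [a1 c1 m1 p1 w1] := D1; have [a2 c2 m2 p2 w2] := D2.
exists (B1 ++ B2), (B1' ++ B2'); split.
- by move=> b; rewrite mem_cat => /orP[/a1|/a2].
- move=> x y; rewrite count_cat c1 c2 /=.
  by have := d x y; case: (R1 x y); case: (R2 x y).
- move=> b c; rewrite !mem_cat => /orP[bB|bB] /orP[cB|cB] bc.
  + exact: m1.
  + exact: leq_trans (cross12 _ _ bB cB) _.
  + exact: leq_trans (cross21 _ _ bB cB) _.
  + exact: m2.
- exact: perm_cat.
- exact: all2_cat.
Qed.

(** * Transport along injections and edge-disjoint unions *)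

Lemma subseq2_map_in (T U : eqType) (f : T -> U) (D : {pred T}) x y b :
  {in D &, injective f} -> x \in D -> y \in D -> {subset b <= D} ->
  subseq [:: f x; f y] (map f b) = subseq [:: x; y] b.
Proof.
move=> fI xD yD; have eqf : {in D &, forall u v, (f u == f v) = (u == v)}.
  by move=> u v uD vD; apply/eqP/eqP => [/fI ->|->].
elim: b => //= z b IH sD; have zD : z \in D by apply: sD; rewrite inE eqxx.
have {}sD : {subset b <= D} by move=> u ub; apply: sD; rewrite inE ub orbT.
rewrite eqf //; case: ifP => _; last by rewrite -IH.
rewrite !sub1seq; apply/mapP/idP => [[u ub e]|yb]; last by exists y.
by rewrite (fI _ _ yD (sD _ ub) e).
Qed.

Lemma good_embed (T U : eqType) (f : T -> U) (D : {pred T}) (R : rel T) (S : rel U) :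
    {in D &, injective f} -> (forall x y, R x y -> (x \in D) && (y \in D)) ->
    {in D &, forall x y, S (f x) (f y) = R x y} ->
    (forall u v, S u v -> exists2 p, (p.1 \in D) && (p.2 \in D) & (u, v) = (f p.1, f p.2)) ->
  good R -> good S.
Proof.
move=> fI RD SR Sf [B [B' DB]]; have [hs hc hm hp hw] := DB.
(* A block has five distinct points, so each of them lies on an edge of [R], and the ends of edges
   are in [D]. *)
have BD b : b \in B -> {subset b <= D}.
  move=> bB x xb; have /andP[ub /eqP sb] := hs _ bB.
  have [y yb yx] : exists2 y, y \in b & y != x.
    case: b ub sb xb {bB} => [|y [|z b]] //= /andP[yz _] _ xb.
    case: (eqVneq y x) => [yx|yx]; last by exists y; rewrite // inE eqxx.
    exists z; first by rewrite !inE eqxx orbT.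
    by apply: contraNneq yz => ->; rewrite yx inE eqxx.
  by case/orP: (mem2_subseq2 yx yb xb) => /(decomposition_cover DB bB) /RD /andP[].
have eqf b c x : b \in B -> c \in B -> x \in b -> (f x \in map f c) = (x \in c).
  move=> bB cB xb; apply/mapP/idP => [[y yc e]|xc]; last by exists x.
  by rewrite (fI _ _ (BD _ bB _ xb) (BD _ cB _ yc) e).
exists (map (map f) B), (map (map f) B'); split.
- move=> _ /mapP[b bB ->]; rewrite size_map map_inj_in_uniq ?hs //.
  by move=> x y /(BD _ bB) xD /(BD _ bB) yD; apply: fI.
- move=> u v; rewrite count_map; case Suv: (S u v).
    have [[x y] /= /andP[xD yD] [eu ev]] := Sf _ _ Suv.
    have Rxy : R x y by rewrite -SR // -eu -ev.
    transitivity (count (subseq [:: x; y]) B); last by rewrite hc Rxy.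
    by apply: eq_in_count => b bB /=; rewrite eu ev (subseq2_map_in fI) //; apply: BD.
  apply/eqP; rewrite -leqn0 leqNgt -has_count; apply/hasP => -[b bB /= sub].
  have /andP[/mapP[x xb eu] /mapP[y yb ev]] := subseq2_mem sub.
  have [xD yD] := (BD _ bB _ xb, BD _ bB _ yb).
  move: sub; rewrite eu ev (subseq2_map_in fI) //; last exact: BD.
  by move=> /(decomposition_cover DB bB); rewrite -SR // -eu -ev Suv.
- move=> _ _ /mapP[b bB ->] /mapP[c cB ->] bc.
  rewrite filter_map size_map (eq_in_filter (a2 := mem c)) => [|x xb]; last exact: eqf xb.
  by apply: hm => //; apply: contraNneq bc => ->.
- exact: perm_map.
- elim: B B' hw {DB hs hc hm hp BD eqf} => [|b B IH] [|c C] //=.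
  move=> /andP[/swappableP[x [y /andP[xy yx]]] /IH ->].
  rewrite andbT; apply/swappableP; exists (f x), (f y).
  have infix_map s t : infix s t -> infix (map f s) (map f t).
    by move=> /infixP[p [q ->]]; apply/infixP; exists (map f p), (map f q); rewrite !map_cat.
  by rewrite (infix_map _ _ xy) (infix_map _ _ yx).
Qed.

Lemma good_has (I T : eqType) (s : seq I) (R : I -> rel T) :
    uniq s -> (forall i, symmetric (R i)) ->
    {in s &, forall i j, i != j -> forall x y, ~~ (R i x y && R j x y)} ->
    {in s, forall i, good (R i)} ->
  good (fun x y => has (fun i => R i x y) s).
Proof.
move=> + sR; elim: s => [|i s IH] /=; first by move=> _ _ _; apply: good0.
move=> /andP[iNs us] dR gR; apply: good_union => //.
- by move=> x y; apply: eq_has => j; rewrite sR.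
- move=> x y; apply/negP => /andP[Ri /hasP[j js Rj]].
  have ij : i != j by apply: contraNneq iNs => ->.
  have /negP[] : ~~ (R i x y && R j x y) by apply: dR => //; rewrite inE ?eqxx ?js ?orbT.
  by rewrite Ri Rj.
- by apply: gR; rewrite inE eqxx.
- apply: IH => // [j k js ks|j js]; last by apply: gR; rewrite inE js orbT.
  by apply: dR; rewrite inE ?js ?ks orbT.
Qed.

(* The points are pairs (part, position), and [sh] lists the sizes of the parts. *)
Definition multipartite (sh : seq nat) : rel (nat * nat) := fun p q =>
  [&& p.1 != q.1, p.2 < nth 0 sh p.1 & q.2 < nth 0 sh q.1].

(** The complete graph, taken as a multipartite graph with singleton parts so that one certificate
    checker serves designs and group divisible designs alike. *)
Definition admissible (v : nat) : Prop := good (multipartite (nseq v 1)).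

Lemma multipartite_nseq1 v p q : multipartite (nseq v 1) p q =
  [&& p.1 != q.1, (p.1 < v) && (p.2 == 0) & (q.1 < v) && (q.2 == 0)].
Proof.
have h i a : (a < nth 0 (nseq v 1) i) = (i < v) && (a == 0).
  by rewrite nth_nseq; case: (i < v); case: a.
by rewrite /multipartite !h.
Qed.

Lemma good_complete (T : eqType) (P : seq T) v : uniq P -> size P = v -> admissible v ->
  good (fun x y => [&& x != y, x \in P & y \in P]).
Proof.
case: P => [|x0 P] uP; first by move=> _ _; apply: good0 => x y; rewrite /= andbF.
move: (x0 :: P) uP => {P} Q uQ sQ.
apply: (good_embed (f := fun p : nat * nat => nth x0 Q p.1)
                   (D := [pred p : nat * nat | (p.1 < v) && (p.2 == 0)])
                   (R := multipartite (nseq v 1))).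
- move=> [i a] [j b] /andP[/= hi /eqP ->] /andP[/= hj /eqP ->] /eqP.
  by rewrite nth_uniq ?sQ // => /eqP ->.
- by move=> p q; rewrite multipartite_nseq1 => /and3P[_ hp hq]; rewrite !inE hp.
- move=> [i a] [j b] /andP[/= hi /eqP ->] /andP[/= hj /eqP ->].
  by rewrite multipartite_nseq1 /= hi hj nth_uniq ?mem_nth ?sQ.
- move=> x y /and3P[_ xQ yQ]; exists ((index x Q, 0), (index y Q, 0)).
    by rewrite !inE /= -sQ !index_mem xQ yQ.
  by rewrite /= !nth_index.
Qed.

Lemma admissible_complete (T : eqType) (P : seq T) v : uniq P -> size P = v ->
  good (fun x y => [&& x != y, x \in P & y \in P]) -> admissible v.
Proof.
move=> uP sP; have eqi : {in P &, forall x y, (index x P == index y P) = (x == y)}.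
  by move=> x y xP yP; apply/eqP/eqP => [e|->//]; rewrite -(nth_index x xP) e nth_index.
apply: (good_embed (f := fun x => (index x P, 0)) (D := mem P)
                   (S := multipartite (nseq v 1))).
- by move=> x y xP yP [/eqP]; rewrite eqi // => /eqP.
- by move=> x y /and3P[_ -> ->].
- move=> x y xP yP; rewrite multipartite_nseq1 /= -sP !index_mem eqi //.
  by rewrite (xP : x \in P) (yP : y \in P).
- move=> [i a] [j b]; rewrite multipartite_nseq1 => /and3P[/= _].
  rewrite -sP => /andP[hi /eqP ->] /andP[hj /eqP ->].
  case: P uP {sP eqi} hi hj => // x0 P uP hi hj.
  exists (nth x0 (x0 :: P) i, nth x0 (x0 :: P) j); first by rewrite !inE -!in_cons !mem_nth.
  by rewrite !index_uniq.
Qed.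

(** Lets the points of part [j] carry arbitrary names, listed in [Q j], in place of positions. *)
Lemma good_parts (T : eqType) (Q : nat -> seq T) (k : nat) (sh : seq nat) :
    (forall j, uniq (Q j)) -> sh = [seq size (Q j) | j <- iota 0 k] ->
    good (fun x y : nat * T => [&& x.1 != y.1, x.1 < k, y.1 < k,
      x.2 \in Q x.1 & y.2 \in Q y.1]) ->
  good (multipartite sh).
Proof.
move=> uQ ->; set shQ := map _ _.
have nsh j : nth 0 shQ j = if j < k then size (Q j) else 0.
  case: ltnP => jk; last by rewrite nth_default // size_map size_iota.
  by rewrite (nth_map 0) ?size_iota // nth_iota.
apply: (good_embed (f := fun x => (x.1, index x.2 (Q x.1)))
                   (D := [pred x : nat * T | (x.1 < k) && (x.2 \in Q x.1)])).
- move=> [i x] [j y] /andP[/= _ xQ] /andP[/= _ yQ] [ij]; rewrite ij in xQ *.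
  by move=> e; rewrite -(nth_index x xQ) e nth_index.
- by move=> x y; rewrite !inE => /and5P[_ -> -> -> ->].
- move=> [i x] [j y] /andP[/= hi xQ] /andP[/= hj yQ].
  by rewrite /multipartite /= !nsh hi hj !index_mem xQ yQ.
- move=> [i a] [j b] /and3P[/= ij]; rewrite !nsh.
  case: ifP => // hi; case: ifP => // hj ha hb.
  have [x0 _] : exists x0, x0 \in Q i by case: (Q i) ha => // x l _; exists x; rewrite inE eqxx.
  exists ((i, nth x0 (Q i) a), (j, nth x0 (Q j) b)); first by rewrite !inE /= hi hj !mem_nth.
  by rewrite /= !index_uniq.
Qed.

Lemma symmetric_multipartite sh : symmetric (multipartite sh).
Proof. by move=> p q; rewrite /multipartite eq_sym; congr (_ && _); rewrite andbC. Qed.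

(** Filling in holes: the complete graph is the edge-disjoint union of the multipartite graph and of
    the complete graphs on each part together with the [e] points at infinity. Two points at
    infinity would have their common edge in every one of these complete graphs, whence [e <= 1]. *)
Lemma good_fill (sh : seq nat) (e : nat) : e <= 1 -> good (multipartite sh) ->
  (forall j, j < size sh -> admissible (nth 0 sh j + e)) -> admissible (sumn sh + e).
Proof.
move=> e1 gsh ash.
pose inf : seq (option (nat * nat)) := nseq e None.
pose Q j := inf ++ [seq Some (j, c) | c <- iota 0 (nth 0 sh j)].
pose P := inf ++ [seq Some (j, c) | j <- iota 0 (size sh), c <- iota 0 (nth 0 sh j)].
have memi j c (F : seq nat) : (Some (j, c) \in inf) = false by rewrite mem_nseq andbF.
have memP x : (x \in P) = if x is Some p then p.2 < nth 0 sh p.1 else 0 < e.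
  rewrite mem_cat mem_nseq; case: x => [[j c]|]; rewrite ?andbF ?eqxx ?andbT /=.
    apply/allpairsPdep/idP => [[i [d [_]]]|hc]; first by rewrite mem_iota => ? [-> ->].
    exists j, c; rewrite !mem_iota; split=> //=.
    by case: (ltnP j (size sh)) hc => // hj; rewrite nth_default.
  by case: (0 < e) => //=; apply/allpairsPdep => -[i [d [_ _]]].
have memQ j x : (x \in Q j) = if x is Some p then (p.1 == j) && (p.2 < nth 0 sh p.1) else 0 < e.
  rewrite mem_cat mem_nseq; case: x => [[i c]|]; rewrite ?andbF ?eqxx ?andbT /=.
    apply/mapP/andP => [[d]|[/eqP -> hc]]; first by rewrite mem_iota => ? [-> ->].
    by exists c; rewrite ?mem_iota.
  by case: (0 < e) => //=; apply/mapP => -[d].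
have uinf : uniq inf by move: e1; rewrite /inf; case: (e) => [|[|]].
have uP : uniq P.
  rewrite cat_uniq uinf allpairs_uniq_dep ?iota_uniq //=.
  - by rewrite andbT; apply/hasPn => _ /allpairsPdep[i [d [_ _ ->]]]; rewrite mem_nseq andbF.
  - by move=> j _; apply: iota_uniq.
  - by move=> [i c] [j d] _ _ /= [-> ->].
have uQ j : uniq (Q j).
  rewrite cat_uniq uinf map_inj_uniq ?iota_uniq => [|c d []] //.
  by rewrite andbT; apply/hasPn => _ /mapP[c _ ->]; rewrite mem_nseq andbF.
have sP : size P = sumn sh + e.
  rewrite size_cat size_nseq size_allpairs_dep addnC; congr (_ + _).
  rewrite -[in RHS](mkseq_nth 0 sh) /mkseq; congr sumn; apply: eq_map => j; exact: size_iota.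
apply: (admissible_complete uP sP).
pose M : rel (option (nat * nat)) := fun x y =>
  if x is Some p then if y is Some q then multipartite sh p q else false else false.
pose K j : rel (option (nat * nat)) := fun x y => [&& x != y, x \in Q j & y \in Q j].
have sK j : symmetric (K j) by move=> x y; rewrite /K eq_sym; congr (_ && _); rewrite andbC.
have gM : good M.
  apply: (good_embed (f := Some) (D := predT) _ _ _ _ gsh) => //.
    by move=> x y _ _ [].
  by move=> [p|] [q|] // _; exists (p, q).
have gK : good (fun x y => has (fun j => K j x y) (iota 0 (size sh))).
  apply: good_has => //; first exact: iota_uniq.
    move=> i j _ _ ij x y; apply/negP; rewrite /K !memQ.
    case: x => [p|]; case: y => [q|] //= h;
      repeat match goal with H : is_true (_ && _) |- _ => case/andP: H => ? ? end => //;
      match goal with H1 : is_true (?p == i), H2 : is_true (?p == j) |- _ =>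
        by rewrite -(eqP H1) -(eqP H2) eqxx in ij end.
  move=> j; rewrite mem_iota => /= hj; apply: good_complete (uQ j) _ (ash j hj).
  by rewrite size_cat size_nseq size_map size_iota addnC.
have d x y : ~~ (M x y && has (fun j => K j x y) (iota 0 (size sh))).
  apply/negP => /andP[]; case: x => // p; case: y => // q; rewrite /M /multipartite.
  move=> /andP[pq _] /hasP[j _]; rewrite /K !memQ => /and3P[_ /andP[/eqP e1' _] /andP[/eqP e2 _]].
  by rewrite e1' e2 eqxx in pq.
apply: good_eq (good_union _ _ d gM gK).
- move=> x y; rewrite /= !memP; apply/orP/and3P => [[|/hasP[j _ /and3P[nxy]]]|].
  + case: x => // p; case: y => // q /and3P[pq hp hq]; split=> //.
    by apply: contraNneq pq => -[->].
  + by rewrite !memQ; case: x nxy => [p|]; case: y => [q|] // nxy; rewrite ?andbT => *; split=> //;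
    repeat match goal with H : is_true (_ && _) |- _ => case/andP: H => ? ? end.
  + move=> [nxy hx hy].
    have exj : forall j c, c < nth 0 sh j -> j \in iota 0 (size sh).
      by move=> j c; rewrite mem_iota /=; case: (ltnP j (size sh)) => // hj; rewrite nth_default.
    case: x nxy hx => [p|]; case: y hy => [q|] //.
    * rewrite /= => hq nxy hp; rewrite /multipartite hp hq !andbT.
      case: (eqVneq p.1 q.1) => [pq|_]; last by left.
      by right; apply/hasP; exists p.1; rewrite ?(exj _ _ hp) // /K !memQ /= eqxx hp pq eqxx hq !andbT.
    * move=> hq nxy hp; right; apply/hasP; exists p.1; first exact: exj hp.
      by rewrite /K !memQ eqxx hp hq.
    * move=> hq nxy hp; right; apply/hasP; exists q.1; first exact: exj hq.
      by rewrite /K !memQ eqxx hp hq.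
- by move=> [p|] [q|] //=; apply: symmetric_multipartite.
- by move=> x y; apply: eq_has => j; apply: sK.
Qed.

(** * Wilson's construction *)

(* [ts] lists the rows of a TD(6,n). *)
Definition transversal_design (n : nat) (ts : seq (seq nat)) : bool :=
  all (fun jk => (jk.1 < jk.2) ==>
         perm_eq [seq (nth 0 t jk.1, nth 0 t jk.2) | t <- ts]
                 [seq (a, b) | a <- iota 0 n, b <- iota 0 n])
      [seq (j, k) | j <- iota 0 6, k <- iota 0 6].

Lemma map_uniq_inj (T U : eqType) (f : T -> U) (s : seq T) :
  uniq (map f s) -> {in s &, injective f}.
Proof.
elim: s => //= z s IH /andP[zNs us] x y; rewrite !inE.
move=> /orP[/eqP ->|xs] /orP[/eqP ->|ys] // e; last exact: IH.
- by case/negP: zNs; rewrite e map_f.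
- by case/negP: zNs; rewrite -e map_f.
Qed.

Section TransversalDesign.
Variables (n : nat) (ts : seq (seq nat)).
Hypothesis td : transversal_design n ts.

Lemma td_perm j k : j < 6 -> k < 6 -> j < k ->
  perm_eq [seq (nth 0 t j, nth 0 t k) | t <- ts] [seq (a, b) | a <- iota 0 n, b <- iota 0 n].
Proof.
move=> hj hk jk; move/allP: td => /(_ (j, k)); rewrite jk; apply.
by apply/allpairsP; exists (j, k); rewrite !mem_iota.
Qed.

Lemma td_uniq : uniq ts.
Proof.
apply/(@map_uniq _ _ (fun t => (nth 0 t 0, nth 0 t 1))).
by rewrite (perm_uniq (@td_perm 0 1 _ _ _)) // allpairs_uniq ?iota_uniq // => -[? ?] [? ?] _ _ [-> ->].
Qed.

Lemma td_inj j k t t' : j < 6 -> k < 6 -> j != k -> t \in ts -> t' \in ts ->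
  nth 0 t j = nth 0 t' j -> nth 0 t k = nth 0 t' k -> t = t'.
Proof.
wlog jk : j k / j < k.
  by case: (ltngtP j k) => // jk W hj hk _ tT tT' e e'; [apply: (W j k)|apply: (W k j)] => //; lia.
move=> hj hk _ tT tT' ej ek.
apply: (map_uniq_inj (f := fun t => (nth 0 t j, nth 0 t k)) (s := ts)) => //=; last by rewrite ej ek.
by rewrite (perm_uniq (td_perm hj hk jk)) // allpairs_uniq ?iota_uniq // => -[? ?] [? ?] _ _ [-> ->].
Qed.

Lemma td_row j k a b : j < 6 -> k < 6 -> j != k -> a < n -> b < n ->
  exists2 t, t \in ts & nth 0 t j = a /\ nth 0 t k = b.
Proof.
wlog jk : j k a b / j < k.
  case: (ltngtP j k) => // jk W hj hk _ ha hb; first by apply: W => //; lia.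
  have kj : k != j by rewrite ltn_eqF.
  by have [t tT [? ?]] := W k j b a jk hk hj kj hb ha; exists t.
move=> hj hk _ ha hb; have := perm_mem (td_perm hj hk jk) (a, b).
have -> : (a, b) \in [seq (a, b) | a <- iota 0 n, b <- iota 0 n].
  by apply/allpairsP; exists (a, b); rewrite !mem_iota.
by move=> /mapP[t tT [-> ->]]; exists t.
Qed.

Lemma td_lt j t : j < 6 -> t \in ts -> nth 0 t j < n.
Proof.
move=> hj tT; pose k := if j == 0 then 1 else 0.
have hk : k < 6 by rewrite /k; case: ifP.
have jk : (j < k) || (k < j) by rewrite /k; case: (j).
have h x y : perm_eq [seq (nth 0 t x, nth 0 t y) | t <- ts] [seq (a, b) | a <- iota 0 n, b <- iota 0 n] ->
    (nth 0 t x < n) && (nth 0 t y < n).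
  move=> /perm_mem /(_ (nth 0 t x, nth 0 t y)); rewrite map_f // => /esym/allpairsP[[a b] [/=]].
  by rewrite !mem_iota /= => ha hb [-> ->]; rewrite ha hb.
by case/orP: jk => jk; [case/andP: (h _ _ (td_perm hj hk jk))|case/andP: (h _ _ (td_perm hk hj jk))].
Qed.

(* Wilson's construction: points of the last group get weight [w i], all others weight [m]. *)
Theorem good_wilson (m : nat) (ws : seq nat) : size ws = n ->
  {in ws, forall w, good (multipartite (rcons (nseq 5 m) w))} ->
  good (multipartite (rcons (nseq 5 (n * m)) (sumn ws))).
Proof.
move=> sws gws.
pose W j i := if j == 5 then nth 0 ws i else m.
pose Q j := [seq (i, c) | i <- iota 0 n, c <- iota 0 (W j i)].
have memQ j x : (x \in Q j) = (x.1 < n) && (x.2 < W j x.1).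
  apply/allpairsPdep/andP => [[i [c []]]|[hi hc]]; first by rewrite !mem_iota => ? ? -> /=.
  by exists x.1, x.2; rewrite !mem_iota; split=> //; case: (x).
(* [R t] is the multipartite graph on the copies of the six points of the row [t]. Two points of
   different groups lie on exactly one row, so these graphs partition the edges. *)
pose R t : rel (nat * (nat * nat)) := fun x y =>
  [&& x.1 != y.1, (x.1 < 6) && (x.2 \in Q x.1) && (nth 0 t x.1 == x.2.1)
                & (y.1 < 6) && (y.2 \in Q y.1) && (nth 0 t y.1 == y.2.1)].
apply: (good_parts (Q := Q) (k := 6)).
- move=> j; apply: allpairs_uniq_dep; first exact: iota_uniq.
    by move=> i _; apply: iota_uniq.
  by move=> [i c] [i' c'] _ _ /= [-> ->].
- have sQ j : size (Q j) = sumn [seq W j i | i <- iota 0 n].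
    by rewrite size_allpairs_dep; congr sumn; apply: eq_map => i; exact: size_iota.
  have sQm j : j != 5 -> size (Q j) = n * m.
    move=> j5; rewrite sQ /W (negbTE j5) -[in RHS](size_iota 0 n).
    by elim: (iota 0 n) => //= _ s ->; rewrite mulSn.
  do 5!(rewrite [LHS]/= [RHS]/=; congr (_ :: _); first by rewrite -(sQm 0)).
  by rewrite sQ /W /= -[in LHS](mkseq_nth 0 ws) sws.
suff : good (fun x y => has (fun t => R t x y) ts).
  apply: good_eq => x y /=.
  apply/hasP/and5P => [[t tT /and3P[xy]]|[xy hx hy xQ yQ]].
    by move=> /andP[/andP[-> ->] _] /andP[/andP[-> ->] _].
  have /andP[hx1 _] : (x.2.1 < n) && (x.2.2 < W x.1 x.2.1) by rewrite -memQ.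
  have /andP[hy1 _] : (y.2.1 < n) && (y.2.2 < W y.1 y.2.1) by rewrite -memQ.
  have [t tT [ex ey]] := td_row hx hy xy hx1 hy1.
  by exists t => //; rewrite /R xy hx hy xQ yQ ex ey !eqxx.
apply: good_has td_uniq _ _ _.
- by move=> t x y; rewrite /R eq_sym; congr (_ && _); rewrite andbC.
- move=> t t' tT tT' tt' x y; apply: contra tt' => /andP[/and3P[xy]].
  move=> /andP[/andP[hx _] /eqP ex] /andP[/andP[hy _] /eqP ey].
  move=> /and3P[_ /andP[_ /eqP ex'] /andP[_ /eqP ey']].
  by apply/eqP; apply: (td_inj hx hy xy) => //; rewrite ?ex ?ex' ?ey ?ey'.
- move=> t tT; have ht : nth 0 t 5 < size ws by rewrite sws td_lt.
  have shW j : nth 0 (rcons (nseq 5 m) (nth 0 ws (nth 0 t 5))) j = if j < 6 then W j (nth 0 t j) else 0.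
    by case: j => [|[|[|[|[|[|[|j]]]]]]] //.
  apply: (good_embed (f := fun p : nat * nat => (p.1, (nth 0 t p.1, p.2)))
     (D := [pred p : nat * nat | (p.1 < 6) && (p.2 < W p.1 (nth 0 t p.1))]) _ _ _ _
     (gws _ (mem_nth 0 ht))).
  + by move=> [i c] [j d] _ _ /= [-> _ ->].
  + move=> [i c] [j d]; rewrite /multipartite !shW !inE /= => /and3P[_].
    by case: ifP => // _ ->; case: ifP => // _ ->.
  + move=> [i c] [j d] /andP[/= hi hc] /andP[/= hj hd].
    by rewrite /R /multipartite /fst /snd !shW hi hj !memQ /= hc hd !td_lt // !eqxx.
  + move=> [i [a c]] [j [b d]] /and3P[/= ij /andP[/andP[hi]]].
    rewrite !memQ /= => /andP[_ hc] /eqP ea /andP[/andP[hj /andP[_ hd]] /eqP eb].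
    by exists ((i, c), (j, d)); rewrite ?inE /= ?hi ?hj ?ea ?eb ?hc ?hd.
Qed.

End TransversalDesign.

(** * Transversal designs over Z/n *)

Lemma coprime_mulI n c y y' : coprime n c -> y < n -> y' < n ->
  c * y = c * y' %[mod n] -> y = y'.
Proof.
move=> cop; wlog le : y y' / y' <= y.
  move=> W hy hy' e; case: (leqP y' y) => [|/ltnW] h; first exact: W.
  by apply/esym; apply: W.
move=> hy hy' /eqP; rewrite eqn_mod_dvd ?leq_mul2l ?le ?orbT // -mulnBr Gauss_dvdr //.
move=> /dvdnP[[|q] e]; first by apply/eqP; rewrite eqn_leq le andbT -subn_eq0 e.
by have := leq_subr y' y; rewrite e mulSn; lia.
Qed.

(* The Desarguesian rows: slopes infinity and 0, ..., 4 over Z/n, whose differences 1, ..., 4 are units. *)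
Definition zmod_row (n x y : nat) : seq nat :=
  y :: [seq (x + k * y) %% n | k <- iota 0 5].

Lemma nth_zmod_row n x y i : i < 5 -> nth 0 (zmod_row n x y) i.+1 = (x + i * y) %% n.
Proof. by move=> hi; rewrite [LHS](nth_map 0) ?size_iota // nth_iota. Qed.

Lemma transversal_design_coprime6 n : coprime n 6 ->
  transversal_design n
    [seq zmod_row n x y | x <- iota 0 n, y <- iota 0 n].
Proof.
move=> cop6; have row0 x y : nth 0 (zmod_row n x y) 0 = y by [].
have := @nth_zmod_row n; move: (zmod_row n) row0 => row row0 rowS.
have copc c : 0 < c < 5 -> coprime n c.
  have c2 : coprime n 2 by apply: coprime_dvdr cop6.
  have c3 : coprime n 3 by apply: coprime_dvdr cop6.
  have c4 : coprime n 4 by rewrite (@coprime_pexpr 2 n 2).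
  by case: c => [|[|[|[|[|c]]]]] // _; rewrite coprimen1.
apply/allP => -[j k] /allpairsP[p []]; rewrite !mem_iota !add0n => /andP[_ hj] /andP[_ hk] e.
case: e => ej ek; rewrite -{}ej in hj; rewrite -{}ek in hk; apply/implyP => /= jk {p}.
rewrite map_allpairs; set pr := (X in perm_eq X _).
have upr : uniq pr.
  have mem z w : (z, w) \in [seq (a, b) | a <- iota 0 n, b <- iota 0 n] -> z < n /\ w < n.
    by move=> /allpairsP[[? ?] [/=]]; rewrite !mem_iota => ? ? [-> ->].
  rewrite {}/pr; apply: allpairs_uniq; rewrite ?iota_uniq // => -[x y] [x' y'].
  move=> /mem[hx hy] /mem[hx' hy'].
  case: j jk hj => [|a] jk hj; case: k jk hk => // b jk hk /=.
    rewrite !row0 !rowS // => -[->] /eqP.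
    by rewrite eqn_modDr !modn_small // => /eqP ->.
  rewrite !rowS // => -[e1 e2].
  have ey : y = y'.
    (* Subtracting the entries of slopes [a < b] eliminates [x] and leaves [(b - a) * y], where
       [b - a] is one of 1, ..., 4. *)
    apply: (@coprime_mulI n (b - a)) => //; first by apply: copc; lia.
    have eb z : b * z = a * z + (b - a) * z by rewrite -mulnDl subnKC // ltnW.
    move: e2; rewrite !eb !addnA -modnDml e1 modnDml => /eqP.
    by rewrite eqn_modDl => /eqP.
  by move: e1; rewrite ey => /eqP; rewrite eqn_modDr !modn_small // => /eqP ->.
have n0 x : x < n -> 0 < n by case: (n).
have sub : {subset pr <= [seq (a, b) | a <- iota 0 n, b <- iota 0 n]}.
  move=> z /allpairsP[[x y] [/=]]; rewrite !mem_iota /= => hx hy ->.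
  have lt i : i < 6 -> nth 0 (row x y) i < n.
    by case: i => [|i] hi; rewrite ?row0 // rowS // ltn_pmod // (n0 x).
  apply/allpairsP; exists (nth 0 (row x y) j, nth 0 (row x y) k).
  by rewrite !mem_iota /= !lt.
(* Surjectivity by counting: the rows give as many distinct pairs as the whole square contains. *)
apply: uniq_perm => //; last by have [] := uniq_min_size upr sub; rewrite ?size_allpairs.
by rewrite allpairs_uniq ?iota_uniq // => -[? ?] [? ?] _ _ [-> ->].
Qed.

(** * Checking designs with a cyclic automorphism group *)

Section Pairs.
Variable T : Type.

Fixpoint pairs (s : seq T) : seq (T * T) :=
  if s is x :: s' then [seq (x, y) | y <- s'] ++ pairs s' else [::].

End Pairs.

Lemma mem_pairs (T : eqType) (x y : T) s : ((x, y) \in pairs s) = subseq [:: x; y] s.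
Proof.
elim: s => //= z s IH; rewrite mem_cat IH.
case: (eqVneq x z) => [<-|xz].
  rewrite mem_map => [|u v []] //; rewrite sub1seq.
  by case ys: (y \in s) => //=; apply: contraFF ys => /subseq2_mem/andP[].
suff -> : (x, y) \in [seq (z, w) | w <- s] = false by [].
by apply/negP => /mapP[w _ [e _]]; rewrite e eqxx in xz.
Qed.

Lemma uniq_flatten_eq (T U : eqType) (t : T -> seq U) (s : seq T) b c e :
  uniq (flatten (map t s)) -> b \in s -> c \in s -> e \in t b -> e \in t c -> b = c.
Proof.
elim: s => //= a s IH; rewrite cat_uniq => /and3P[_ /hasPn dis us].
have out d : d \in s -> e \in t d -> e \notin t a.
  by move=> ds ed; apply: dis; apply/flattenP; exists (t d); rewrite ?map_f.
rewrite !inE => /orP[/eqP ->|bs] /orP[/eqP ->|cs] // eb ec; last exact: IH.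
- by have := out _ cs ec; rewrite eb.
- by have := out _ bs eb; rewrite ec.
Qed.

(** Turns an equality of multisets of keys into a rearrangement of the objects that carry them; this
    is how pi is recovered from the trades recorded in a certificate. *)
Lemma perm_map_lift (T U : eqType) (h : T -> U) (s : seq T) (t : seq U) :
  perm_eq t (map h s) -> exists2 s', perm_eq s' s & map h s' = t.
Proof.
case: s => [|x0 s]; first by move/perm_nilP => ->; exists [::].
move/(perm_iotaP (h x0)) => [Is pIs ->]; rewrite size_map in pIs.
exists (map (nth x0 (x0 :: s)) Is).
  by apply: perm_trans (perm_map _ pIs) _; rewrite map_nth_iota0 // take_size.
rewrite -map_comp; apply/eq_in_map => i; rewrite (perm_mem pIs) mem_iota => /andP[_ hi].
by symmetry; apply: nth_map.
Qed.

(** * Orders on binary integers, for computation *)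

Definition leN := BinNat.N.leb.
(** Serves to compare multisets of pairs: two lists with the same sorted form are permutations of
    each other. *)
Definition lexN (p q : BinNums.N * BinNums.N) : bool :=
  if p.1 == q.1 then leN p.2 q.2 else leN p.1 q.1.

Lemma leN_trans : transitive leN.
Proof.
move=> y x z /BinNat.N.leb_le xy /BinNat.N.leb_le yz; apply/BinNat.N.leb_le.
exact: BinNat.N.le_trans xy yz.
Qed.

Lemma leN_anti : antisymmetric leN.
Proof. by move=> x y /andP[/BinNat.N.leb_le xy /BinNat.N.leb_le yx]; apply: BinNat.N.le_antisymm. Qed.

Lemma leN_total : total leN.
Proof.
move=> x y; case: (BinNat.N.le_ge_cases x y) => /BinNat.N.leb_le h; apply/orP.
- by left.
- by right.
Qed.

Definition ltN := BinNat.N.ltb.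

Lemma ltN_trans : transitive ltN.
Proof.
move=> y x z /BinNat.N.ltb_lt xy /BinNat.N.ltb_lt yz; apply/BinNat.N.ltb_lt.
exact: BinNat.N.lt_trans xy yz.
Qed.

Lemma ltN_irr : irreflexive ltN.
Proof. exact: BinNat.N.ltb_irrefl. Qed.


Definition points (sh : seq nat) : seq (nat * nat) :=
  [seq (j, c) | j <- iota 0 (size sh), c <- iota 0 (nth 0 sh j)].

Lemma size_points sh : size (points sh) = sumn sh.
Proof.
rewrite size_allpairs_dep -[in RHS](mkseq_nth 0 sh) /mkseq; congr sumn.
by apply: eq_map => j; apply: size_iota.
Qed.

Lemma uniq_points sh : uniq (points sh).
Proof.
apply: allpairs_uniq_dep; rewrite ?iota_uniq //; first by move=> i _; apply: iota_uniq.
by move=> [i j] [i' j'] _ _ /= [-> ->].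
Qed.

Lemma mem_points sh p : (p \in points sh) = (p.2 < nth 0 sh p.1).
Proof.
apply/allpairsPdep/idP => [[i [c [_]]]|hp]; first by rewrite mem_iota => hc -> /=.
exists p.1, p.2; rewrite !mem_iota; split=> //=; last by case: (p).
by case: (ltnP p.1 (size sh)) hp => // h; rewrite nth_default.
Qed.

Lemma infix_nth (T : eqType) (x0 : T) (b : seq T) i : size b == 5 -> i < 4 ->
  infix [:: nth x0 b i; nth x0 b i.+1] b.
Proof.
case: b => [|a0 [|a1 [|a2 [|a3 [|a4 [|]]]]]] // _.
case: i => [|[|[|[|]]]] // _; apply/infixP.
- by exists [::], [:: a2; a3; a4].
- by exists [:: a0], [:: a3; a4].
- by exists [:: a0; a1], [:: a4].
- by exists [:: a0; a1; a2], [::].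
Qed.

(** Empty when [x] is not in [b], since [index] is then the length of [b]. *)
Definition after (T : eqType) (x : T) (b : seq T) : seq T := behead (drop (index x b) b).

Lemma count_after (T : eqType) (x y : T) b : uniq b ->
  count_mem y (after x b) = subseq [:: x; y] b.
Proof.
rewrite /after; elim: b => //= z b IH /andP[zb ub].
rewrite [z == x]eq_sym; case: (eqVneq x z) => [_|xz]; last exact: IH.
by rewrite drop0 count_uniq_mem // sub1seq.
Qed.

Lemma iter_in (T : Type) (D : {pred T}) (g : T -> T) n x :
  {in D, forall y, g y \in D} -> x \in D -> iter n g x \in D.
Proof. by move=> gD xD; elim: n => //= n; apply: gD. Qed.

Lemma iter_map (T : Type) (g : T -> T) n (b : seq T) : iter n (map g) b = map (iter n g) b.
Proof. by elim: n => [|n /= ->]; rewrite ?map_id // -map_comp. Qed.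

Lemma perm_traject (T : eqType) (h : T -> T) n x : iter n h x = x ->
  perm_eq (map h (traject h x n)) (traject h x n).
Proof.
have -> : map h (traject h x n) = traject h (h x) n by elim: n x => //= n IH x; rewrite IH.
move=> e; rewrite -(perm_cons x); have := trajectSr h x n; rewrite /= e => ->.
by rewrite perm_rcons.
Qed.

(** * Reduction to one point of each orbit *)

Section Orbits.
Variables (T : eqType) (D : {pred T}) (g : T -> T) (n : nat) (R : rel T) (B : seq (seq T)).
Hypotheses (n_gt0 : 0 < n) (gD : {in D, forall x, g x \in D})
  (gn : {in D, forall x, iter n g x = x}).
Hypotheses (BD : {in B, forall b : seq T, uniq b && all D b}) (gB : perm_eq (map (map g) B) B).
Hypothesis gR : {in D &, forall x y, R (g x) (g y) = R x y}.

Let gI : {in D &, injective g}.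
Proof.
move=> x y xD yD e; rewrite -(gn xD) -(gn yD) -(prednK n_gt0) !iterSr.
by rewrite e.
Qed.

Let gS x : x \in D -> exists2 y, y \in D & x = g y.
Proof.
move=> xD; exists (iter n.-1 g x); first exact: iter_in.
by rewrite -iterS prednK // gn.
Qed.

Definition covers_from x := {in D, forall y, count (subseq [:: x; y]) B = R x y}.

(** Super-simplicity localised at a common point: two blocks sharing three points are detected at
    any one of these, so the property at all points is the global one, and it travels along
    orbits. *)
Definition super_simple_at x := {in B &, forall b c : seq T, b != c ->
  x \in b -> x \in c -> size [seq y <- b | y \in c] <= 2}.

Let DB b : b \in B -> {subset b <= D}.
Proof. by move=> /BD/andP[_ /allP]. Qed.

(** Applying [g] to all blocks only permutes [B], so the pairs [(g x, g z)] and [(x, z)] occur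
    equally often. *)
Lemma covers_from_iter x i : x \in D -> covers_from x -> covers_from (iter i g x).
Proof.
move=> xD cx; elim: i => //= i IH y yD; have := iter_in i gD xD.
move: (iter i g x) IH => {}x cx' {cx}xD; have [z zD ->] := gS yD.
rewrite gR // -cx' // -(permP gB) count_map; apply: eq_in_count => b bB /=.
by apply: subseq2_map_in gI xD zD (DB bB).
Qed.

Lemma super_simple_at_iter x i : x \in D -> super_simple_at x -> super_simple_at (iter i g x).
Proof.
move=> xD sx; elim: i => //= i IH; have := iter_in i gD xD.
move: (iter i g x) IH => {}x sx' {sx}xD b c; rewrite -!(perm_mem gB).
move=> /mapP[{}b bB ->] /mapP[{}c cB ->] bc.
have mem_g y d : y \in D -> d \in B -> (g y \in map g d) = (y \in d).
  move=> yD dB; apply/mapP/idP => [[z zd e]|yd]; last by exists y.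
  by rewrite (gI yD _ e) // (DB dB).
rewrite !mem_g // => xb xc; rewrite filter_map size_map.
rewrite (eq_in_filter (a2 := mem c)); last by move=> y /(DB bB) yD; apply: mem_g.
by apply: sx'; rewrite //; apply: contraNneq bc => ->.
Qed.


End Orbits.

Lemma nat_of_addN (x y : BinNums.N) : BinNat.N.add x y = x + y :> nat.
Proof. by case: x y => [|p] [|q] //=; rewrite ?addn0 // nat_of_add_pos. Qed.

Lemma leN_nat x y : leN x y = ((x : nat) <= y).
Proof.
have le u w : BinNat.N.le u w -> ((u : nat) <= w).
  by move/BinNat.N.sub_add => <-; rewrite nat_of_addN leq_addl.
apply/idP/idP => [/BinNat.N.leb_le/le //|h]; apply/BinNat.N.leb_le.
case: (BinNat.N.le_ge_cases x y) => // /le h'.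
by rewrite (can_inj nat_of_binK (anti_leq (introT andP (conj h h')))); apply: BinNat.N.le_refl.
Qed.

Lemma ltN_nat x y : ltN x y = ((x : nat) < y).
Proof. by rewrite /ltN BinNat.N.ltb_antisym -/(leN y x) leN_nat ltnNge. Qed.

(** * Certificates and their soundness *)

Section Certificates.

Local Notation N := BinNums.N.

(** The permutation that rotates successive intervals of lengths [cs] by one place and fixes
    everything beyond them. *)
Fixpoint step (cs : seq N) (x : N) : N :=
  if cs is c :: cs' then
    if ltN x c then (if BinNat.N.succ x == c then BinNums.N0 else BinNat.N.succ x)
    else BinNat.N.add c (step cs' (BinNat.N.sub x c))
  else x.

Fixpoint cycles (x : N) (cs : seq N) : seq (N * N) :=
  if cs is c :: cs' then (x, c) :: cycles (BinNat.N.add x c) cs' else [::].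

Definition develop (g : N -> N) (n : nat) (Z : seq (seq N * (nat * nat))) :
    seq (seq N * (nat * nat)) :=
  flatten [seq [seq (b, z.2) | b <- traject (map g) z.1 n] | z <- Z].

(* A block comes with positions [(p, q)]: its entries at [p, p + 1] are those swapped by its own
   trade, its entries at [q, q + 1] those swapped when it is the partner of another block. *)
Definition trade_from (z : seq N * (nat * nat)) : N * N :=
  (nth BinNums.N0 z.1 z.2.1.+1, nth BinNums.N0 z.1 z.2.1).
(** Read forwards, whereas [trade_from] is read backwards: the two keys agree when the partner
    contains the same adjacent points in the opposite order. *)
Definition trade_to (z : seq N * (nat * nat)) : N * N :=
  (nth BinNums.N0 z.1 z.2.2, nth BinNums.N0 z.1 z.2.2.+1).

Definition binary (p : nat * nat) : N * N := (bin_of_nat p.1, bin_of_nat p.2).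

(** The points that follow [r] in its blocks must be those of the other parts, once each; pairs
    ending in [r] are counted from their first point. For super-simplicity, the unordered pairs that
    complete [r] to a triple inside a block are coded as [v * x + y] with [x] before [y] in sorted
    order; strict increase of the sorted codes means that no triple through [r] is repeated. *)
Definition check_from (ps : seq N) (lab : N -> nat) (v : N) (B : seq (seq N)) (r : N) : bool :=
  let Br := [seq b <- B | r \in b] in
  [&& ltN r v, sort leN (flatten [seq after r b | b <- Br]) == [seq y <- ps | lab r != lab y]
    & sorted ltN (sort leN [seq BinNat.N.add (BinNat.N.mul v t.1) t.2
                       | t <- flatten [seq pairs (sort leN (rem r b)) | b <- Br]])].

(* [pts] sends the points [0, 1, ...] to those of the multipartite graph, and [cs] lists the lengths
   of the cycles, on consecutive points, of an automorphism of order [n]; by invariance one point of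
   each cycle suffices in [check_from]. *)
Definition check (sh : seq nat) (pts : seq (nat * nat)) (cs : seq N) (n : nat)
    (Z : seq (seq N * (nat * nat))) : bool :=
  let v := bin_of_nat (sumn sh) in
  let ps := map bin_of_nat (iota 0 (sumn sh)) in
  let g := step cs in
  let labs := unzip1 pts in
  let labs' := [seq nth 0 labs (g x) | x <- ps] in
  let H := [seq nth 0 labs' (index j labs) | j <- iota 0 (size sh)] in
  let D := develop g n Z in
  let B := unzip1 D in
  [&& 0 < n, sort lexN (map binary pts) == sort lexN (map binary (points sh)),
      all (fun x => ltN (g x) v && (iter n g x == x)) ps,
      flatten [seq traject g c.1 (c.2 : N) | c <- cycles BinNums.N0 cs] == ps,
      map (nth 0 H) labs == labs',
      all (fun z => [&& uniq z.1, all (ltN^~ v) z.1, size z.1 == 5, z.2.1 < 4 & z.2.2 < 4]) Z,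
      all (fun c => check_from ps (nth 0 labs) v B c.1) (cycles BinNums.N0 cs)
    & sort lexN [seq trade_from z | z <- D] == sort lexN [seq trade_to z | z <- D]].

(** Both the graph and the block list are invariant under [g], so the tests at orbit representatives
    extend to all points; the equality of the two multisets of trade keys supplies pi. *)
Lemma check_good sh pts cs n Z : check sh pts cs n Z -> good (multipartite sh).
Proof.
case/and4P => n_gt0 /eqP hpts /allP hg /and5P[/eqP hcyc /eqP hlab /allP hZ /allP hfrom /eqP htrade].
set v := sumn sh in hg hcyc hlab hZ hfrom.
set ps := map _ (iota 0 v) in hg hcyc hlab hfrom.
set g := step cs in hg hcyc hlab hfrom htrade.
(* [H] tabulates the action of [g] on the parts: the part of [g x] depends only on the part of
   [x]. *)
have {hlab}[H hlab] : exists H, map (nth 0 H) (unzip1 pts) = [seq nth 0 (unzip1 pts) (g x) | x <- ps].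
  by eexists; exact: hlab.
set lab := nth 0 (unzip1 pts) in hlab hfrom.
set D := develop g n Z in hfrom htrade; set B := unzip1 D in hfrom.
have {}hpts : perm_eq pts (points sh).
  have binI : injective binary.
    by move=> [a b] [c d] [/(can_inj bin_of_natK) -> /(can_inj bin_of_natK) ->].
  by apply: (perm_map_inj binI); rewrite -(perm_sort lexN) hpts perm_sort.
pose dom : {pred N} := [pred x : N | (x : nat) < v].
have psE x : (x \in ps) = (x \in dom).
  rewrite inE; apply/mapP/idP => [[i] |hx]; first by rewrite mem_iota => hi ->; rewrite bin_of_natK.
  by exists (x : nat); rewrite ?mem_iota ?nat_of_binK.
have gD : {in dom, forall x, g x \in dom}.
  by move=> x; rewrite -psE => /hg/andP[]; rewrite ltN_nat bin_of_natK.
have gn : {in dom, forall x, iter n g x = x}.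
  by move=> x; rewrite -psE => /hg/andP[_ /eqP].
have orbit x : x \in dom -> exists2 c, c \in cycles BinNums.N0 cs & exists i, x = iter i g c.1.
  rewrite -psE -hcyc => /flattenP[_ /mapP[c hc ->]] /trajectP[i _ ->].
  by exists c => //; exists i.
have size_pts : size pts = v by rewrite (perm_size hpts) size_points.
have lab_step x : x \in dom -> lab (g x) = nth 0 H (lab x).
  move=> xD; have := congr1 (fun s => nth 0 s x) hlab.
  rewrite (nth_map 0) ?size_map ?size_pts // => -> //.
  rewrite (nth_map BinNums.N0) ?size_map ?size_iota // (nth_map 0) ?size_iota //.
  by rewrite nth_iota // nat_of_binK.
have lab_iter i x y : x \in dom -> y \in dom -> lab x = lab y -> lab (iter i g x) = lab (iter i g y).
  move=> xD yD e; elim: i => //= i IH; rewrite !lab_step ?IH //; exact: iter_in.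
(* Distinct parts stay distinct because the inverse of [g] is its power [n.-1], which also maps
   parts into parts. *)
have labg : {in dom &, forall x y, (lab (g x) != lab (g y)) = (lab x != lab y)}.
  move=> x y xD yD; congr (~~ _); apply/eqP/eqP; last exact: (lab_iter 1).
  move/(lab_iter n.-1 _ _ (gD x xD) (gD y yD)).
  by rewrite -!iterSr prednK // !gn.
have hB b : b \in B -> exists z i, [/\ z \in Z, i < n & b = map (iter i g) z.1].
  case/mapP => _ /flattenP[_ /mapP[z zZ ->] /mapP[b' /trajectP[i hi ->] ->]] ->.
  by exists z, i; rewrite -iter_map.
have giI i : {in dom &, injective (iter i g)}.
  elim: i => //= i IH x y xD yD e; apply: (IH x y xD yD).
  have gI : {in dom &, injective g}.
    by move=> u w uD wD ew; rewrite -(gn u uD) -(gn w wD) -(prednK n_gt0) !iterSr ew.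
  by apply: gI e; apply: iter_in.
have ZD z : z \in Z -> {subset z.1 <= dom}.
  case/hZ/and5P => _ /allP h _ _ _ x /h; by rewrite ltN_nat bin_of_natK.
have hB5 : {in B, forall b, [&& uniq b, size b == 5 & all dom b]}.
  move=> b /hB[z [i [zZ _ ->]]]; have [uz _ sz _ _] := and5P (hZ z zZ).
  rewrite size_map sz map_inj_in_uniq ?uz.
    by apply/allP => _ /mapP[x /(ZD z zZ) xD ->]; exact: (iter_in i gD xD).
  by move=> x y /(ZD z zZ) xD /(ZD z zZ) yD; apply: (giI i x y xD yD).
have BD : {in B, forall b, uniq b && all dom b} by move=> b /hB5/and3P[-> _ ->].
have BS b : b \in B -> {subset b <= dom} by move=> /BD/andP[_ /allP].
have gB : perm_eq (map (map g) B) B.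
  have -> : B = flatten [seq traject (map g) z.1 n | z <- Z].
    rewrite /B /D /develop /unzip1 map_flatten -map_comp; congr flatten.
    by apply: eq_map => z /=; rewrite -map_comp map_id.
  rewrite map_flatten -map_comp; elim: (Z) ZD => //= z s IH zD; apply: perm_cat.
    apply: perm_traject; rewrite iter_map -[RHS]map_id; apply/eq_in_map => x xz.
    by rewrite gn // (zD z (mem_head _ _)).
  by apply: IH => z' z's; apply: zD; rewrite inE z's orbT.
pose R x y := [&& x \in dom, y \in dom & lab x != lab y].
have gR : {in dom &, forall x y, R (g x) (g y) = R x y}.
  by move=> x y xD yD; rewrite /R !gD // labg // xD yD.
have repD c : c \in cycles BinNums.N0 cs -> c.1 \in dom.
  by move=> hc; have /and3P[] := hfrom c hc; rewrite ltN_nat bin_of_natK.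
have cov x : x \in dom -> covers_from dom R B x.
  move=> /orbit[c hc [i ->]]; apply: (covers_from_iter n_gt0 gD gn BD gB gR); first exact: repD.
  have /and3P[_ /eqP hr _] := hfrom c hc; move=> y yD.
  have -> : R c.1 y = (y \in [seq z : N <- ps | lab c.1 != lab z]).
    by rewrite mem_filter psE /R yD repD // andbT.
  rewrite -count_uniq_mem; last first.
    by rewrite filter_uniq // map_inj_uniq ?iota_uniq //; apply: can_inj bin_of_natK.
  rewrite -hr (permP (permEl (perm_sort _ _))) count_flatten -map_comp.
  rewrite -(sumn_count (fun b => subseq [:: c.1; y] b)) sumnE big_map.
  rewrite sumnE big_map big_filter [RHS]big_mkcond /= big_seq [RHS]big_seq; apply: eq_bigr => b bB.
  have /andP[ub _] := BD b bB; rewrite count_after //.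
  by case: ifP => // hb; apply/eqP; rewrite eqb0; apply: contraFN hb => /subseq2_mem/andP[].
have ss x : x \in dom -> super_simple_at B x.
  move=> /orbit[c hc [i ->]]; apply: (super_simple_at_iter n_gt0 gD gn BD gB); first exact: repD.
  have /and3P[_ _ hr] := hfrom c hc; move: (c.1) hr => {hc}r hr b b' bB b'B bb' rb rb'.
  rewrite leqNgt; apply: contra bb' => h3; apply/eqP.
  have [/andP[ub _] /andP[ub' _]] := (BD b bB, BD b' b'B).
  (* The common points other than [r], in increasing order. The same list arises from either block,
     so its first two entries form a pair that would be listed for both. *)
  pose fb := [seq y <- sort leN (rem r b) | y \in b'].
  have srt d : sorted leN (sort leN d) by apply: sort_sorted leN_total _.
  have e : fb = [seq y <- sort leN (rem r b') | y \in b].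
    apply: (sorted_eq leN_trans leN_anti); rewrite ?(sorted_filter leN_trans) //.
    apply: uniq_perm; rewrite ?filter_uniq ?sort_uniq ?rem_uniq // => y.
    rewrite !mem_filter !mem_sort !mem_rem_uniq // !inE.
    by case: (y \in b); case: (y \in b'); rewrite ?andbF ?andbT.
  have : 1 < size fb.
    rewrite size_filter (permP (permEl (perm_sort _ _))).
    have /permP/(_ (mem b')) := perm_to_rem rb; rewrite /= -size_filter rb' => e'.
    by rewrite size_filter in e' h3; rewrite e' in h3.
  case efb : fb => [|y [|z s]] // _.
  have sub : subseq [:: y; z] fb by rewrite efb /= !eqxx sub0seq.
  have tb : (y, z) \in pairs (sort leN (rem r b)).
    by rewrite mem_pairs; apply: subseq_trans sub (filter_subseq _ _).
  have tb' : (y, z) \in pairs (sort leN (rem r b')).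
    by rewrite mem_pairs; rewrite e in sub; apply: subseq_trans sub (filter_subseq _ _).
  apply: (uniq_flatten_eq (t := fun d => pairs (sort leN (rem r d)))
                          (s := [seq d <- B | r \in d]) _ _ _ tb tb').
  - by have := sorted_uniq ltN_trans ltN_irr hr; rewrite sort_uniq => /map_uniq.
  - by rewrite mem_filter rb.
  - by rewrite mem_filter rb'.
have [B' pB' wB'] : exists2 B', perm_eq B' B & all2 (@swappable _) B B'.
  have [Z' pZ' eZ'] : exists2 Z', perm_eq Z' D & map trade_to Z' = map trade_from D.
    by apply: perm_map_lift; rewrite -(perm_sort lexN) htrade perm_sort.
  exists (unzip1 Z'); first exact: perm_map.
  pose valid (z : seq N * (nat * nat)) := [&& size z.1 == 5, z.2.1 < 4 & z.2.2 < 4].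
  have aD : all valid D.
    apply/allP => d /flattenP[_ /mapP[z zZ ->] /mapP[b /trajectP[i _ ->] ->]].
    have [_ _ sz hp hq] := and5P (hZ z zZ).
    by rewrite /valid /= iter_map size_map sz hp hq.
  have aZ' : all valid Z' by rewrite (perm_all _ pZ').
  rewrite /B; elim: (D) Z' aD aZ' eZ' {pZ'} => [|z s IH] [|z' s'] //=.
  move=> /andP[/and3P[sz hp _] aD] /andP[/and3P[sz' _ hq] aZ'] [e1 e2 e3].
  rewrite IH // andbT; apply/swappableP.
  exists (nth BinNums.N0 z.1 z.2.1), (nth BinNums.N0 z.1 z.2.1.+1).
  by rewrite infix_nth //= -e1 -e2 infix_nth.
have gRn : good R.
  exists B, B'; split=> //.
  - by move=> b /hB5/and3P[-> -> _].
  - move=> x y; case xD: (x \in dom); last first.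
      rewrite /R xD /=; apply/eqP; rewrite -leqn0 leqNgt -has_count; apply/hasP => -[b bB].
      by move/subseq2_mem => /andP[xb _]; rewrite (BS b bB) in xD.
    case yD: (y \in dom); first exact: cov.
    rewrite /R yD andbF; apply/eqP; rewrite -leqn0 leqNgt -has_count; apply/hasP => -[b bB].
    by move/subseq2_mem => /andP[_ yb]; rewrite (BS b bB) in yD.
  move=> b c bB cB bc; case ebc: [seq x <- b | x \in c] => [//|x s].
  have : x \in [seq x <- b | x \in c] by rewrite ebc mem_head.
  rewrite mem_filter -ebc => /andP[xc xb]; apply: (ss x) => //; exact: BS xb.
apply: (@good_embed _ _ (fun x : N => nth (0, 0) pts x) dom R) gRn.
- move=> x y; rewrite !inE => hx hy /eqP.
  by rewrite nth_uniq ?size_pts ?(perm_uniq hpts) ?uniq_points // => /eqP/(can_inj nat_of_binK).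
- by move=> x y /and3P[-> ->].
- move=> x y xD yD; rewrite /R xD yD /multipartite /= -!mem_points -!(perm_mem hpts).
  by rewrite !mem_nth ?size_pts // !andbT /lab !(nth_map (0, 0)) ?size_pts.
move=> p q; rewrite /multipartite -!mem_points -!(perm_mem hpts) => /and3P[_ hp hq].
exists (bin_of_nat (index p pts), bin_of_nat (index q pts)).
  by rewrite !inE !bin_of_natK -size_pts !index_mem hp hq.
by rewrite !bin_of_natK !nth_index.
Qed.

End Certificates.

(** * Explicit designs *)

Number Notation BinNums.N BinNat.N.of_num_uint BinNat.N.to_num_uint : N_scope.

Definition block5 (a b c d e : BinNums.N) (p q : nat) : seq BinNums.N * (nat * nat) :=
  ([:: a; b; c; d; e], (p, q)).
Arguments block5 (a b c d e)%_num (p q)%_nat.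

Definition check_cyclic (d : nat * nat * seq (seq BinNums.N * (nat * nat))) : bool :=
  let: (v, n, Z) := d in
  check (nseq v 1) [seq (i, 0) | i <- iota 0 v]
    (map bin_of_nat (nseq (v %/ n) n ++ nseq (v %% n) 1)) n Z.

(** [gdd_parts] names the part of each of the points 0, 1, ...; the position of a point in its part
    is the number of earlier points there. *)
Record gdd := Gdd {
  gdd_shape : seq nat;
  gdd_parts : seq nat;
  gdd_cycles : seq nat;
  gdd_order : nat;
  gdd_blocks : seq (seq BinNums.N * (nat * nat)) }.

Definition check_gdd (d : gdd) : bool :=
  let parts := gdd_parts d in
  check (gdd_shape d)
    [seq (nth 0 parts i, count_mem (nth 0 parts i) (take i parts)) | i <- iota 0 (size parts)]
    (map bin_of_nat (gdd_cycles d)) (gdd_order d) (gdd_blocks d).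

(* Lines [c + m i] and reversed parabolas [c + m i + i ^ 2], for [n] prime to 6. *)
Definition transversal_gdd (n : nat) : gdd :=
  let curve e m := [seq bin_of_nat (i * n + (i * m + e * i ^ 2) %% n) | i <- iota 0 5] in
  Gdd (nseq 5 n ++ [:: 0]) [seq i %/ n | i <- iota 0 (5 * n)] (nseq 5 n) n
    ([seq (curve 0 m, (0, 0)) | m <- iota 0 n] ++ [seq (rev (curve 1 m), (3, 3)) | m <- iota 0 n]).

(** The v(v-1)/10 blocks form (v-1)/10 orbits under Z/v when v is 1 modulo 10. When v is 5 modulo 10
    they form v/5 orbits under an automorphism of order (v-1)/2 with two long cycles and one fixed
    point. *)
Definition cyclic_designs : seq (nat * nat * seq (seq BinNums.N * (nat * nat))) := [::
  (21, 21, [::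
     block5 10 17 6 9 15 0 0; block5 14 7 18 15 9 0 0]);
  (25, 12, [::
     block5 22 5 12 0 13 0 0; block5 10 21 24 8 13 3 3; block5 19 18 10 14 12 2 2;
     block5 5 11 8 7 17 0 0; block5 16 13 9 10 2 1 1]);
  (31, 31, [::
     block5 0 11 3 18 24 0 1; block5 23 1 21 2 6 0 1; block5 23 0 22 17 19 0 1]);
  (35, 17, [::
     block5 16 18 34 0 27 0 0; block5 18 30 9 1 23 1 2; block5 2 10 16 12 28 0 2;
     block5 32 13 30 19 16 0 0; block5 27 28 30 0 24 0 0; block5 5 10 0 4 25 2 3;
     block5 22 21 16 29 14 0 0]);
  (41, 41, [::
     block5 31 37 22 29 33 1 1; block5 7 35 38 6 21 3 3; block5 38 32 16 13 33 3 3;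
     block5 38 27 7 15 20 1 1]);
  (45, 22, [::
     block5 26 38 20 30 35 3 3; block5 30 29 32 18 40 2 2; block5 17 7 40 38 33 3 3;
     block5 14 31 44 27 2 1 2; block5 2 32 19 1 26 2 2; block5 23 2 7 13 15 3 3;
     block5 14 6 42 26 33 1 1; block5 21 39 15 2 0 3 3; block5 42 43 1 20 16 3 3]);
  (51, 51, [::
     block5 37 6 40 21 32 2 2; block5 1 20 41 32 50 0 0; block5 13 36 42 1 18 0 1;
     block5 41 34 48 42 38 2 1; block5 10 47 32 9 34 0 2]);
  (55, 27, [::
     block5 38 30 10 31 52 2 2; block5 31 4 54 14 49 1 2; block5 25 42 49 0 31 3 3;
     block5 9 3 8 28 31 1 1; block5 44 14 5 43 41 0 0; block5 28 36 17 12 51 2 2;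
     block5 40 19 45 11 51 0 0; block5 16 46 5 14 1 0 0; block5 11 22 19 26 12 1 1;
     block5 30 26 40 5 42 0 0; block5 47 51 37 11 14 3 3]);
  (61, 61, [::
     block5 13 48 5 50 4 2 3; block5 17 4 50 25 36 1 2; block5 21 33 49 43 11 0 1;
     block5 57 9 53 16 50 3 3; block5 25 50 51 39 20 0 2; block5 10 37 16 14 19 0 0]);
  (65, 32, [::
     block5 62 40 1 37 21 2 2; block5 17 19 15 35 22 3 3; block5 28 33 11 35 34 2 2;
     block5 21 47 63 55 0 1 1; block5 22 8 7 37 31 1 1; block5 60 34 10 54 37 1 1;
     block5 51 15 25 56 31 0 0; block5 56 60 49 14 47 0 0; block5 6 3 49 28 63 2 2;
     block5 58 53 43 39 9 2 2; block5 59 22 64 26 39 3 3; block5 21 43 3 15 16 3 3;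
     block5 18 5 58 37 26 1 1]);
  (71, 71, [::
     block5 47 60 36 38 41 1 0; block5 29 65 24 63 62 0 2; block5 70 44 55 24 28 2 2;
     block5 38 17 34 58 24 0 2; block5 55 63 38 69 10 2 2; block5 28 21 56 43 44 2 1;
     block5 63 2 34 55 11 1 2]);
  (75, 37, [::
     block5 0 8 36 4 18 0 0; block5 30 63 47 0 9 2 2; block5 34 0 17 73 32 2 2;
     block5 43 0 74 23 44 1 2; block5 0 72 50 64 68 1 1; block5 7 55 13 58 0 0 0;
     block5 0 31 37 59 49 2 2; block5 24 71 0 53 25 0 0; block5 3 37 30 5 45 3 3;
     block5 11 68 37 8 0 3 3; block5 14 37 46 35 44 2 2; block5 48 36 37 61 21 3 3;
     block5 49 13 37 54 24 2 2; block5 37 57 73 67 22 0 0; block5 63 37 65 60 4 3 3]);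
  (81, 81, [::
     block5 64 0 38 10 67 3 3; block5 24 40 59 65 17 3 3; block5 6 53 43 28 37 0 0;
     block5 61 69 65 30 66 3 3; block5 53 21 23 2 36 3 3; block5 21 12 1 19 64 3 3;
     block5 45 69 57 68 8 0 0; block5 20 34 12 60 7 2 2]);
  (85, 42, [::
     block5 0 5 81 38 37 3 3; block5 0 74 10 62 63 2 2; block5 0 68 13 59 11 3 3;
     block5 0 75 34 50 36 1 1; block5 0 61 84 42 7 1 2; block5 0 6 73 72 70 3 3;
     block5 16 60 0 30 71 3 3; block5 78 0 9 25 65 3 0; block5 0 31 79 4 28 1 1;
     block5 6 42 60 23 35 0 1; block5 42 14 61 63 57 2 2; block5 42 38 39 16 19 1 1;
     block5 80 42 50 0 21 3 3; block5 24 75 59 81 42 2 1; block5 42 62 52 76 47 2 0;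
     block5 68 42 2 10 37 0 1; block5 42 32 70 8 77 0 0]);
  (91, 91, [::
     block5 57 25 24 48 46 0 0; block5 50 86 52 23 2 0 2; block5 76 24 39 32 64 3 3;
     block5 35 84 87 7 79 3 3; block5 59 42 28 18 24 0 0; block5 86 14 32 48 26 0 0;
     block5 29 30 59 14 34 1 2; block5 3 20 30 68 81 0 0; block5 72 7 52 16 49 1 2]);
  (95, 47, [::
     block5 7 0 86 49 75 2 2; block5 30 27 0 70 60 3 3; block5 0 35 21 6 43 1 1;
     block5 37 38 0 19 84 1 1; block5 48 0 14 45 13 1 1; block5 56 0 94 4 76 3 3;
     block5 17 0 67 12 81 1 1; block5 0 82 25 41 51 1 3; block5 47 2 28 4 87 0 0;
     block5 47 89 81 9 53 2 2; block5 47 35 26 88 15 1 1; block5 47 27 19 30 93 0 0;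
     block5 47 31 76 18 72 1 1; block5 47 65 48 34 11 2 2; block5 66 47 17 78 69 2 2;
     block5 47 70 1 8 79 3 3; block5 77 47 74 3 51 2 2; block5 47 24 82 80 29 2 2;
     block5 92 47 52 5 60 0 0]);
  (101, 101, [::
     block5 0 3 47 20 51 1 1; block5 0 7 76 13 18 1 1; block5 0 10 78 90 73 0 0;
     block5 0 32 88 86 72 0 0; block5 0 41 37 66 67 0 0; block5 0 50 9 64 42 1 1;
     block5 0 57 81 8 2 0 0; block5 0 59 49 23 94 1 1; block5 0 62 19 53 89 0 0;
     block5 0 83 21 82 98 1 1]);
  (111, 111, [::
     block5 64 17 39 32 43 1 1; block5 3 110 73 31 43 3 3; block5 55 20 72 9 108 3 3;
     block5 69 89 19 9 17 3 0; block5 69 16 30 35 53 3 3; block5 52 61 12 46 28 3 3;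
     block5 62 95 57 92 26 1 1; block5 55 36 27 65 10 2 2; block5 64 10 35 13 37 2 2;
     block5 95 94 38 30 51 0 2; block5 43 106 86 92 93 1 3]);
  (115, 57, [::
     block5 25 59 114 112 32 1 2; block5 57 32 25 54 3 3 3; block5 112 0 59 3 54 3 3;
     block5 3 39 35 111 8 0 0; block5 54 18 60 22 49 0 0; block5 33 104 43 79 82 0 0;
     block5 67 24 92 89 14 0 0; block5 84 13 92 61 102 0 0; block5 44 87 79 110 69 0 0;
     block5 40 21 94 55 7 0 0; block5 17 36 2 50 77 0 0; block5 16 8 63 28 61 3 3;
     block5 41 108 49 110 29 3 3; block5 71 98 22 5 4 2 2; block5 100 35 52 73 53 1 1;
     block5 95 101 10 84 51 3 3; block5 47 76 70 6 87 3 3; block5 80 113 85 40 71 0 0;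
     block5 91 58 86 100 17 0 0; block5 51 108 95 107 88 0 0; block5 63 6 76 64 83 0 0;
     block5 6 8 91 70 19 0 0; block5 80 51 49 101 38 1 1]);
  (131, 131, [::
     block5 69 121 28 49 50 0 1; block5 2 51 109 33 48 3 3; block5 109 64 103 121 117 0 0;
     block5 91 68 93 96 81 3 3; block5 114 7 24 89 30 2 2; block5 16 116 78 105 52 1 2;
     block5 70 49 100 86 3 1 1; block5 4 13 11 67 87 2 2; block5 51 124 38 22 119 1 1;
     block5 108 75 19 38 107 1 1; block5 26 17 121 113 61 1 3; block5 9 108 20 86 112 2 2;
     block5 111 60 20 30 13 0 0]);
  (141, 141, [::
     block5 0 4 114 58 77 0 0; block5 0 23 86 74 2 0 0; block5 0 33 126 127 30 0 0;
     block5 0 41 13 7 59 0 0; block5 0 49 115 39 17 0 0; block5 0 60 35 40 24 0 0;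
     block5 0 61 132 103 53 0 0; block5 0 80 9 38 88 0 0; block5 0 81 106 101 117 0 0;
     block5 0 92 26 102 124 0 0; block5 0 100 128 134 82 0 0; block5 0 108 15 14 111 0 0;
     block5 0 118 55 67 139 0 0; block5 0 137 27 83 64 0 0]);
  (161, 161, [::
     block5 0 12 69 151 152 0 0; block5 0 14 145 50 101 0 0; block5 0 17 4 23 113 0 0;
     block5 0 24 126 49 64 0 0; block5 0 29 47 67 153 0 0; block5 0 33 2 91 28 0 0;
     block5 0 43 11 116 119 0 0; block5 0 54 134 100 93 0 0; block5 0 107 27 61 68 0 0;
     block5 0 118 150 45 42 0 0; block5 0 128 159 70 133 0 0; block5 0 132 114 94 8 0 0;
     block5 0 137 35 112 97 0 0; block5 0 144 157 138 48 0 0; block5 0 147 16 111 60 0 0;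
     block5 0 149 92 10 9 0 0]);
  (211, 211, [::
     block5 0 29 183 39 52 1 1; block5 0 41 202 78 85 0 0; block5 0 48 149 45 187 0 0;
     block5 0 57 111 93 77 0 0; block5 0 71 33 89 204 0 3; block5 0 72 76 75 100 1 1;
     block5 0 74 125 165 9 1 1; block5 0 82 50 186 194 0 3; block5 0 96 110 156 47 0 3;
     block5 0 106 65 128 30 1 1; block5 0 109 15 98 16 0 3; block5 0 114 157 27 69 0 3;
     block5 0 141 108 119 35 0 0; block5 0 160 145 150 131 0 0; block5 0 167 188 130 103 1 1;
     block5 0 169 31 90 19 0 3; block5 0 190 159 99 116 0 0; block5 0 191 143 155 66 1 1;
     block5 0 203 26 198 84 0 3; block5 0 205 64 152 62 1 1; block5 0 207 181 49 2 0 0])].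

(** The first eleven are the graphs m^5 w placed on the rows in Wilson's construction; the others
    serve [fills]. Part labels such as [i %% 6] on a single long cycle make the automorphism a
    translation that permutes the parts. The shapes with many parts of size 1 are complete graphs
    with a hole of order 21. *)
Definition gdds : seq gdd := [::
  Gdd (nseq 6 2)
    ([seq i %/ 2 | i <- iota 0 12])
    (nseq 6 2) 2 [::
     block5 0 7 9 4 3 0 0; block5 2 4 7 8 11 0 0; block5 4 2 1 10 9 0 0; block5 6 1 11 3 4 0 0;
     block5 8 10 4 6 0 0 0; block5 10 8 3 1 7 0 0];
  Gdd (nseq 5 4 ++ [:: 2])
    ([seq i %/ 4 | i <- iota 0 20] ++ nseq 2 5)
    (nseq 5 4 ++ [:: 2]) 4 [::
     block5 0 19 5 20 15 0 0; block5 7 17 0 12 9 1 1; block5 20 4 12 11 17 3 3;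
     block5 8 12 20 7 3 3 3; block5 8 15 17 1 5 3 3; block5 8 19 0 6 13 1 1;
     block5 12 5 0 16 10 3 3; block5 12 19 1 8 4 1 1; block5 3 16 11 13 20 0 0;
     block5 6 20 10 0 18 3 3];
  Gdd (nseq 6 4)
    ([seq i %/ 4 | i <- iota 0 24])
    (nseq 6 4) 4 [::
     block5 0 4 8 21 16 3 3; block5 0 17 10 14 6 2 2; block5 22 4 9 2 15 3 3;
     block5 4 23 17 13 0 3 3; block5 12 8 0 22 18 0 0; block5 13 8 6 17 3 0 0;
     block5 0 12 19 20 9 2 2; block5 12 10 7 17 21 1 1; block5 11 12 23 1 6 0 0;
     block5 16 0 23 7 15 2 2; block5 16 6 22 1 8 1 1; block5 20 17 5 8 15 2 2];
  Gdd (nseq 5 6 ++ [:: 0])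
    ([seq i %/ 6 | i <- iota 0 30])
    (nseq 5 6) 6 [::
     block5 0 16 7 21 29 3 3; block5 0 26 9 22 12 3 3; block5 18 13 8 0 28 3 3;
     block5 6 25 23 14 0 1 1; block5 6 24 1 12 21 2 2; block5 8 5 12 29 18 3 3;
     block5 19 12 28 0 6 2 2; block5 20 25 11 4 12 0 0; block5 18 7 12 3 24 2 2;
     block5 17 0 18 25 10 0 0; block5 24 0 15 11 23 1 1; block5 24 14 18 4 6 1 1];
  Gdd (nseq 6 6)
    ([seq i %% 6 | i <- iota 0 36])
    ([:: 36]) 36 [::
     block5 0 19 10 17 32 1 3; block5 0 14 11 16 1 3 2; block5 0 25 20 29 28 1 2];
  Gdd (nseq 5 6 ++ [:: 8])
    ([seq i %% 4 | i <- iota 0 24] ++ nseq 6 4 ++ nseq 8 5)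
    ([:: 24; 6; 8]) 24 [::
     block5 0 32 11 28 5 2 3; block5 0 13 26 6 31 1 1; block5 0 30 15 27 14 3 3;
     block5 0 7 9 36 10 1 1; block5 24 30 2 0 21 2 2];
  Gdd (nseq 5 8 ++ [:: 0])
    ([seq i %% 2 | i <- iota 0 16] ++ [seq 2 + i %% 2 | i <- iota 0 16] ++ nseq 8 4)
    ([:: 16; 16; 8]) 16 [::
     block5 33 1 0 22 17 0 0; block5 31 0 13 37 28 2 2; block5 27 38 15 26 0 3 3;
     block5 7 25 34 16 0 2 2; block5 27 8 3 16 39 2 2; block5 16 12 15 19 37 3 3;
     block5 32 18 5 19 12 1 1; block5 14 24 32 17 3 0 0];
  Gdd (nseq 6 8)
    ([seq i %% 6 | i <- iota 0 48])
    ([:: 48]) 48 [::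
     block5 0 10 26 45 47 3 3; block5 0 17 7 8 22 0 0; block5 0 41 33 13 44 3 3;
     block5 0 43 29 27 4 2 2];
  Gdd (nseq 5 10 ++ [:: 0])
    ([seq i %% 2 | i <- iota 0 20] ++ [seq 2 + i %% 2 | i <- iota 0 20] ++ nseq 10 4)
    ([:: 20; 20; 10]) 20 [::
     block5 0 26 29 3 46 0 2; block5 0 30 1 42 21 3 3; block5 0 34 49 9 33 0 0;
     block5 39 0 19 36 47 3 3; block5 1 20 6 33 46 1 1; block5 20 44 10 3 21 2 2;
     block5 5 49 20 2 27 1 1; block5 40 2 30 25 17 1 3; block5 40 23 32 1 8 3 3;
     block5 21 40 26 14 5 0 0];
  Gdd (nseq 5 10 ++ [:: 4])
    ([seq i %% 2 | i <- iota 0 20] ++ [seq 2 + i %% 2 | i <- iota 0 20] ++ nseq 10 4 ++ nseq 4 5)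
    ([:: 20; 20; 10; 4]) 20 [::
     block5 0 25 1 51 28 3 3; block5 34 0 29 46 9 2 2; block5 0 20 41 13 39 2 2;
     block5 0 52 35 43 36 3 3; block5 20 1 31 8 46 3 3; block5 2 35 49 20 5 1 1;
     block5 20 4 43 3 27 2 2; block5 6 40 20 37 11 1 1; block5 44 20 12 33 53 0 0;
     block5 21 8 30 40 19 2 2; block5 50 0 40 15 32 1 1; block5 40 35 50 17 14 1 1];
  Gdd (nseq 6 10)
    ([seq i %% 6 | i <- iota 0 60])
    ([:: 60]) 60 [::
     block5 35 0 15 16 19 3 2; block5 22 9 0 59 7 2 3; block5 25 38 11 0 21 1 3;
     block5 8 0 17 31 28 0 3; block5 0 39 5 32 34 0 2];
  Gdd (nseq 6 24)
    ([seq i %% 6 | i <- iota 0 144])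
    ([:: 144]) 144 [::
     block5 0 16 109 104 35 3 3; block5 0 46 20 21 131 0 0; block5 0 33 22 127 50 1 1;
     block5 0 142 63 56 101 0 0; block5 0 130 134 73 27 3 3; block5 83 8 0 97 82 0 0;
     block5 0 86 10 135 91 1 1; block5 0 80 106 13 15 3 3; block5 89 0 141 112 44 3 3;
     block5 0 113 122 40 3 0 0; block5 136 23 115 87 0 0 0; block5 0 140 7 124 39 1 1];
  Gdd (nseq 6 24 ++ [:: 20])
    ([seq i %% 6 | i <- iota 0 144] ++ nseq 20 6)
    ([:: 144; 18; 2]) 144 [::
     block5 5 73 0 16 57 3 3; block5 27 0 89 110 158 1 1; block5 0 97 28 51 116 0 0;
     block5 35 0 163 74 121 3 3; block5 139 0 58 113 122 2 2; block5 71 63 151 0 103 3 3;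
     block5 0 80 141 82 31 2 2; block5 0 105 130 119 154 3 3; block5 0 106 153 99 143 3 3;
     block5 0 148 131 111 43 1 1; block5 117 50 40 85 0 3 3; block5 124 29 0 33 144 1 1;
     block5 65 134 0 135 91 3 3; block5 144 5 43 22 51 3 3; block5 144 104 10 102 117 3 3;
     block5 17 144 13 142 20 2 2];
  Gdd (nseq 5 34 ++ [:: 24])
    ([seq i %% 4 | i <- iota 0 136] ++ nseq 34 4 ++ nseq 24 5)
    ([:: 136; 34; 8; 8; 8]) 136 [::
     block5 17 0 146 70 103 0 1; block5 41 2 0 63 157 1 3; block5 55 42 0 176 153 1 1;
     block5 0 57 50 140 27 3 3; block5 162 0 105 107 58 0 2; block5 74 0 165 85 180 1 1;
     block5 93 0 111 143 102 2 2; block5 119 0 189 14 156 1 0; block5 0 122 179 69 59 1 2;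
     block5 0 125 136 175 135 1 1; block5 0 131 1 149 30 1 1; block5 161 90 0 45 71 1 1;
     block5 173 43 169 82 0 3 3; block5 187 0 19 13 34 2 2; block5 0 137 25 192 99 1 3;
     block5 136 0 184 3 121 2 2; block5 100 43 136 5 176 2 2; block5 136 109 74 28 190 2 2;
     block5 136 55 29 106 52 3 3; block5 170 92 97 3 70 2 2; block5 4 178 41 137 79 0 1;
     block5 93 178 160 6 72 0 0; block5 7 186 72 148 14 3 3];
  Gdd (nseq 5 34 ++ [:: 44])
    ([seq i %% 2 | i <- iota 0 68] ++ [seq 2 + i %% 2 | i <- iota 0 68] ++ nseq 34 4 ++ nseq 44 5)
    ([:: 68; 68; 34] ++ nseq 11 4) 68 [::
     block5 3 108 0 188 151 3 3; block5 159 0 67 190 123 2 2; block5 17 0 77 185 147 3 3;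
     block5 102 33 0 203 129 1 1; block5 103 0 84 171 138 1 1; block5 0 153 89 122 193 0 0;
     block5 201 128 63 155 0 0 0; block5 72 0 137 85 182 0 0; block5 140 112 202 99 0 2 2;
     block5 169 41 213 86 0 3 3; block5 106 172 29 97 0 2 2; block5 0 132 174 135 15 1 2;
     block5 184 37 113 80 0 3 3; block5 194 154 0 87 110 1 1; block5 0 158 208 95 1 0 0;
     block5 157 68 73 11 180 0 0; block5 68 193 58 131 13 1 1; block5 38 17 68 212 87 2 2;
     block5 24 68 158 198 43 1 1; block5 45 34 155 68 97 2 2; block5 56 68 147 51 204 0 0;
     block5 68 52 183 61 154 0 0; block5 64 68 49 161 187 0 0; block5 83 68 189 29 40 0 0;
     block5 6 68 175 105 149 1 2; block5 141 36 170 68 65 0 0; block5 68 9 181 22 142 3 3;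
     block5 30 68 77 209 148 2 2; block5 68 177 162 31 12 1 1; block5 28 68 194 15 129 2 2;
     block5 53 2 207 135 68 2 2; block5 68 119 210 55 160 3 3; block5 208 7 136 82 14 3 3;
     block5 136 9 201 113 102 1 1; block5 29 136 110 180 22 3 3; block5 136 51 75 28 172 0 0;
     block5 1 136 80 4 176 1 1; block5 136 46 67 96 195 0 0; block5 97 136 122 27 194 3 3;
     block5 86 211 117 136 19 2 2; block5 170 70 146 28 69 1 1; block5 147 174 102 2 109 0 0;
     block5 178 85 128 37 2 3 3; block5 64 178 70 136 135 0 0; block5 164 182 93 132 1 0 0;
     block5 186 122 69 48 136 1 1; block5 137 186 112 3 91 0 0; block5 190 28 1 122 143 3 3;
     block5 50 68 190 109 166 0 0; block5 194 84 169 33 2 1 1; block5 126 47 69 198 141 2 2;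
     block5 13 71 198 38 116 2 2; block5 71 202 35 10 167 0 0; block5 202 25 73 136 94 3 3;
     block5 75 143 92 206 2 1 1; block5 137 33 210 90 24 2 2];
  Gdd (nseq 6 30 ++ [:: 40])
    ([seq i %% 6 | i <- iota 0 180] ++ nseq 40 6)
    ([:: 180] ++ nseq 4 10) 180 [::
     block5 0 11 182 110 67 1 0; block5 0 13 135 142 216 3 3; block5 0 207 25 58 27 2 2;
     block5 0 37 68 57 89 2 0; block5 0 190 63 155 28 2 2; block5 0 65 79 172 194 1 1;
     block5 0 70 49 179 8 3 3; block5 0 73 212 167 134 3 3; block5 0 80 95 40 121 2 1;
     block5 97 0 119 217 75 0 0; block5 106 125 0 206 50 0 1; block5 0 116 101 82 204 1 2;
     block5 0 117 185 1 176 3 3; block5 0 128 191 10 163 1 1; block5 0 143 186 86 133 0 2;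
     block5 177 0 184 157 148 3 3; block5 0 196 103 77 100 1 1; block5 0 51 198 178 164 3 3;
     block5 0 205 34 131 38 2 2; block5 136 211 175 0 71 2 2; block5 214 0 45 91 17 0 0;
     block5 1 30 180 99 142 1 2; block5 1 200 112 17 105 3 3];
  Gdd (nseq 7 30 ++ [:: 20])
    ([seq i %% 7 | i <- iota 0 210] ++ nseq 20 7)
    ([:: 210] ++ nseq 10 2) 210 [::
     block5 0 1 225 153 192 1 2; block5 0 3 130 37 187 3 3; block5 0 10 18 78 198 2 2;
     block5 104 0 88 19 100 2 2; block5 33 0 228 136 149 1 2; block5 0 54 79 183 200 3 3;
     block5 0 55 220 64 199 3 3; block5 0 65 210 11 174 1 2; block5 141 0 74 167 89 0 0;
     block5 0 96 171 4 176 1 1; block5 0 99 214 160 101 3 3; block5 113 0 217 185 62 0 0;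
     block5 0 115 166 197 165 2 2; block5 125 0 208 122 46 3 3; block5 0 128 148 32 108 3 3;
     block5 139 0 145 186 169 3 3; block5 143 71 181 0 23 2 2; block5 0 202 173 36 58 1 1;
     block5 177 0 227 204 53 3 3; block5 0 179 218 195 92 0 0; block5 0 201 212 155 102 1 2;
     block5 0 205 222 137 40 3 3];
  Gdd (nseq 6 34 ++ [:: 30])
    ([seq i %% 6 | i <- iota 0 204] ++ nseq 30 6)
    ([:: 204; 12; 12; 6]) 204 [::
     block5 0 47 1 188 99 0 0; block5 8 177 207 61 0 1 2; block5 195 0 19 26 204 2 2;
     block5 38 0 58 129 217 3 3; block5 41 104 0 121 45 3 3; block5 2 210 0 106 203 0 1;
     block5 0 152 226 130 123 3 3; block5 0 189 140 161 127 1 1; block5 143 205 117 0 200 0 1;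
     block5 0 113 81 146 31 1 1; block5 0 157 101 147 160 0 0; block5 148 51 0 37 62 1 1;
     block5 154 0 109 44 231 3 3; block5 165 0 73 95 64 0 0; block5 0 32 167 181 183 0 0;
     block5 0 224 110 179 43 1 1; block5 0 184 232 111 116 2 2; block5 215 0 193 23 74 3 3;
     block5 166 221 79 39 0 3 3; block5 203 184 9 85 204 2 2; block5 6 216 21 88 61 0 0;
     block5 132 7 99 216 140 3 3; block5 228 2 201 72 121 3 3];
  Gdd (nseq 84 1 ++ [:: 21])
    (iota 0 85 ++ nseq 20 84)
    ([:: 42; 42] ++ nseq 21 1) 42 [::
     block5 0 10 21 28 40 2 2; block5 0 35 31 34 36 0 0; block5 0 43 99 80 24 1 2;
     block5 0 44 96 60 39 3 3; block5 0 45 89 53 22 0 0; block5 0 48 88 70 4 1 2;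
     block5 0 54 102 50 32 0 0; block5 0 55 93 29 61 0 0; block5 0 63 87 20 67 0 0;
     block5 0 64 100 73 27 1 2; block5 0 68 97 56 16 1 2; block5 0 76 95 57 9 1 2;
     block5 42 0 98 33 82 1 2; block5 42 1 101 27 43 1 2; block5 42 6 90 83 14 3 3;
     block5 42 8 103 25 45 3 3; block5 42 9 104 4 55 1 2; block5 42 12 86 26 53 3 3;
     block5 42 22 92 35 52 0 0; block5 42 29 85 10 62 0 0; block5 42 30 91 66 13 0 0;
     block5 42 34 84 7 73 1 2; block5 42 39 94 3 68 0 0; block5 42 76 49 81 67 1 1;
     block5 42 77 54 71 56 3 3];
  Gdd (nseq 114 1 ++ [:: 21])
    (iota 0 115 ++ nseq 20 114)
    ([:: 57; 57] ++ nseq 21 1) 57 [::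
     block5 0 1 79 38 108 2 2; block5 0 25 27 20 16 1 1; block5 0 29 44 42 21 2 2;
     block5 53 0 39 59 64 1 1; block5 103 0 117 61 19 0 0; block5 0 71 116 31 91 0 0;
     block5 0 74 114 9 102 0 0; block5 0 92 121 65 11 1 2; block5 0 95 125 6 72 0 0;
     block5 0 97 115 81 24 1 2; block5 94 0 123 100 28 0 0; block5 0 101 128 8 75 3 3;
     block5 0 105 5 23 45 2 2; block5 106 0 127 85 14 3 3; block5 5 57 126 58 37 0 0;
     block5 8 57 129 112 2 1 2; block5 57 10 122 7 97 1 2; block5 11 57 134 107 44 0 0;
     block5 57 19 130 76 18 0 0; block5 20 57 131 74 46 0 0; block5 57 23 35 13 111 3 3;
     block5 57 9 120 78 26 3 3; block5 57 39 118 12 95 3 3; block5 57 45 124 52 68 1 2;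
     block5 57 50 119 34 92 1 2; block5 57 53 133 80 6 3 3; block5 57 55 132 84 1 3 3;
     block5 75 57 67 69 83 1 0; block5 70 57 61 79 103 2 1; block5 57 94 27 82 89 1 1;
     block5 57 110 100 24 113 0 1];
  transversal_gdd 25;
  transversal_gdd 31].

(** In an entry [(m, n, a, b)], a TD(6,n) gets weight [m] on five groups; on the last group [a]
    points get the second weight of [weights m], [b] points the third, and the others the first. *)
Definition routes : seq (nat * nat * nat * nat) := [::
  (0, 0, 0, 0); (0, 0, 0, 0); (0, 0, 0, 0); (0, 0, 0, 0); (0, 0, 0, 0); (0, 0, 0, 0);
  (0, 0, 0, 0); (0, 0, 0, 0); (0, 0, 0, 0); (0, 0, 0, 0); (0, 0, 0, 0); (0, 0, 0, 0);
  (0, 0, 0, 0); (0, 0, 0, 0); (0, 0, 0, 0); (0, 0, 0, 0); (0, 0, 0, 0); (0, 0, 0, 0);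
  (0, 0, 0, 0); (0, 0, 0, 0); (4, 5, 0, 5); (0, 0, 0, 0); (0, 0, 0, 0); (0, 0, 0, 0);
  (0, 0, 0, 0); (0, 0, 0, 0); (6, 5, 0, 0); (0, 0, 0, 0); (0, 0, 0, 0); (0, 0, 0, 0);
  (6, 5, 2, 1); (6, 5, 4, 0); (6, 5, 5, 0); (6, 5, 3, 2); (6, 5, 0, 5); (0, 0, 0, 0);
  (8, 5, 0, 0); (2, 17, 0, 0); (0, 0, 0, 0); (0, 0, 0, 0); (0, 0, 0, 0); (8, 5, 3, 0);
  (0, 0, 0, 0); (0, 0, 0, 0); (8, 5, 5, 0); (4, 11, 0, 1); (10, 5, 0, 0); (4, 11, 0, 6);
  (4, 11, 0, 9); (4, 11, 0, 11); (10, 5, 5, 0); (10, 5, 1, 2); (10, 5, 0, 3); (10, 5, 1, 3);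
  (10, 5, 0, 4); (10, 5, 1, 4); (10, 5, 0, 5); (6, 9, 3, 2); (6, 9, 4, 2); (6, 9, 6, 1);
  (8, 8, 0, 0); (6, 9, 9, 0); (6, 9, 6, 3); (6, 9, 4, 5); (6, 9, 1, 8); (8, 8, 3, 0);
  (10, 7, 0, 0); (4, 16, 0, 1); (8, 8, 5, 0); (4, 16, 0, 6); (10, 7, 5, 0); (10, 7, 6, 0);
  (10, 7, 5, 1); (10, 7, 6, 1); (10, 7, 5, 2); (10, 7, 1, 4); (10, 8, 0, 0); (10, 7, 1, 5);
  (10, 7, 0, 6); (10, 7, 1, 6); (10, 8, 5, 0); (10, 8, 6, 0); (10, 8, 5, 1); (10, 8, 6, 1);
  (10, 8, 5, 2); (10, 8, 6, 2); (10, 9, 0, 0); (10, 8, 1, 5); (10, 8, 0, 6); (10, 8, 1, 6);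
  (10, 9, 5, 0); (10, 9, 6, 0); (10, 9, 5, 1); (10, 9, 6, 1); (10, 9, 5, 2); (10, 9, 6, 2);
  (10, 9, 5, 3); (10, 9, 6, 3); (10, 9, 5, 4); (10, 9, 1, 6); (10, 9, 0, 7); (10, 9, 1, 7);
  (10, 9, 0, 8); (10, 9, 1, 8); (10, 9, 0, 9); (8, 13, 3, 0); (10, 11, 0, 0); (4, 25, 0, 2);
  (8, 13, 5, 0); (4, 25, 0, 7); (10, 11, 5, 0); (10, 11, 6, 0); (10, 11, 5, 1); (10, 11, 6, 1);
  (10, 11, 10, 0); (10, 11, 11, 0); (10, 11, 10, 1); (10, 11, 6, 3); (10, 11, 5, 4);
  (10, 11, 6, 4); (10, 11, 5, 5); (10, 11, 6, 5); (10, 11, 5, 6); (10, 11, 1, 8); (10, 11, 0, 9);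
  (10, 11, 1, 9); (10, 13, 0, 0); (10, 11, 1, 10); (10, 11, 0, 11); (6, 19, 13, 2);
  (10, 13, 5, 0); (10, 13, 6, 0); (10, 13, 5, 1); (10, 13, 6, 1); (10, 13, 10, 0);
  (10, 13, 11, 0); (10, 13, 10, 1); (10, 13, 11, 1); (10, 13, 10, 2); (10, 13, 11, 2);
  (10, 13, 10, 3); (10, 13, 6, 5); (10, 13, 5, 6); (10, 13, 6, 6); (10, 13, 5, 7);
  (10, 13, 6, 7); (10, 13, 5, 8); (10, 13, 1, 10); (10, 13, 0, 11); (10, 13, 1, 11);
  (10, 13, 0, 12); (10, 13, 1, 12); (10, 13, 0, 13); (6, 25, 3, 2); (6, 25, 4, 2); (6, 25, 6, 1);
  (10, 16, 0, 0); (6, 25, 9, 0); (6, 25, 10, 0); (6, 25, 8, 2); (10, 16, 5, 0); (10, 16, 6, 0);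
  (10, 16, 5, 1); (10, 16, 6, 1); (10, 16, 10, 0); (10, 16, 11, 0); (10, 17, 0, 0);
  (10, 16, 11, 1); (10, 16, 15, 0); (10, 16, 16, 0); (10, 17, 5, 0); (10, 17, 6, 0);
  (10, 17, 5, 1); (10, 17, 6, 1); (10, 17, 10, 0); (10, 17, 11, 0); (10, 17, 10, 1);
  (10, 17, 11, 1); (10, 17, 15, 0); (10, 17, 16, 0); (10, 17, 15, 1); (10, 17, 16, 1);
  (10, 17, 15, 2); (10, 17, 11, 4); (10, 17, 10, 5); (10, 17, 11, 5); (10, 19, 0, 0);
  (10, 17, 11, 6); (10, 17, 10, 7); (10, 17, 6, 9); (10, 19, 5, 0); (10, 19, 6, 0);
  (10, 19, 5, 1); (10, 19, 6, 1); (10, 19, 10, 0); (10, 19, 11, 0); (10, 19, 10, 1);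
  (10, 19, 11, 1); (10, 19, 15, 0); (10, 19, 16, 0); (10, 19, 15, 1); (10, 19, 16, 1);
  (10, 19, 15, 2); (10, 19, 16, 2); (10, 19, 15, 3); (10, 19, 16, 3); (10, 19, 15, 4);
  (10, 19, 11, 6); (10, 19, 10, 7); (10, 19, 11, 7); (10, 19, 10, 8); (10, 19, 11, 8);
  (10, 19, 10, 9); (10, 19, 6, 11); (10, 19, 5, 12); (10, 19, 6, 12); (10, 19, 5, 13);
  (10, 19, 6, 13); (10, 19, 5, 14); (10, 19, 1, 16); (10, 19, 0, 17); (10, 19, 1, 17);
  (10, 19, 0, 18); (10, 19, 1, 18); (10, 19, 0, 19); (8, 25, 18, 0); (10, 23, 0, 0);
  (6, 35, 16, 1); (8, 25, 20, 0); (6, 35, 19, 0)].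

Lemma cyclic_designsP : all check_cyclic cyclic_designs.
Proof. by vm_compute. Qed.

Lemma gddsP : all check_gdd gdds.
Proof. by vm_compute. Qed.

Lemma admissible1 : admissible 1.
Proof. by apply: good0 => p q; rewrite multipartite_nseq1; lia. Qed.

Definition cyclic_orders : seq nat := 1 :: [seq d.1.1 | d <- cyclic_designs].

Lemma admissible_cyclic v : v \in cyclic_orders -> admissible v.
Proof.
rewrite inE => /orP[/eqP ->|/mapP[[[w n] Z] dD ->]]; first exact: admissible1.
by have /= := allP cyclic_designsP _ dD; apply: check_good.
Qed.

Definition gdd_shapes : seq (seq nat) := [seq gdd_shape d | d <- gdds].

Lemma good_gdd sh : sh \in gdd_shapes -> good (multipartite sh).
Proof.
rewrite /gdd_shapes; elim: gdds gddsP => //= d ds IH /andP[dP dsP].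
by rewrite inE => /orP[/eqP ->|]; [apply: check_good dP | apply: IH].
Qed.

(** These give, in turn, the orders 105, 135, 125, 155, 145, 165, 195, 215, 221, 231 and 235. The
    second component is the number of points at infinity. *)
Definition fills : seq (seq nat * nat) := [::
  (nseq 84 1 ++ [:: 21], 0); (nseq 114 1 ++ [:: 21], 0); (nseq 5 25 ++ [:: 0], 0);
  (nseq 5 31 ++ [:: 0], 0); (nseq 6 24, 1); (nseq 6 24 ++ [:: 20], 1); (nseq 5 34 ++ [:: 24], 1);
  (nseq 5 34 ++ [:: 44], 1); (nseq 6 30 ++ [:: 40], 1);
  (nseq 7 30 ++ [:: 20], 1); (nseq 6 34 ++ [:: 30], 1)].

Definition check_fill (s : seq nat * nat) : bool :=
  [&& s.2 <= 1, s.1 \in gdd_shapes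
    & all (fun g => (g + s.2 == 0) || (g + s.2 \in cyclic_orders)) s.1].

Lemma fillsP : all check_fill fills.
Proof. by vm_compute. Qed.

Definition direct_orders : seq nat := cyclic_orders ++ [seq sumn s.1 + s.2 | s <- fills].

Lemma admissible_direct v : v \in direct_orders -> admissible v.
Proof.
rewrite mem_cat => /orP[|/mapP[[sh e] sF ->]]; first exact: admissible_cyclic.
have /and3P[/= e1 /good_gdd gsh /allP ash] := allP fillsP _ sF.
apply: good_fill => // j hj; have /orP[/eqP ->|] := ash _ (mem_nth 0 hj).
  by apply: good0 => p q; rewrite multipartite_nseq1; lia.
exact: admissible_cyclic.
Qed.

(** * The spectrum *)

(** Addition of GF(p^k), with a polynomial over Z/p coded by its coefficients as base-p digits. *)
Fixpoint digit_add (p k x y : nat) : nat :=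
  if k is k'.+1 then (x + y) %% p + p * digit_add p k' (x %/ p) (y %/ p) else 0.

(* Rows [y, y + a x] over GF(q), with [maps] tabulating [x |-> a x] for five elements [a]. *)
Definition field_rows (q p k : nat) (maps : seq (seq nat)) : seq (seq nat) :=
  [seq x :: [seq digit_add p k y (nth 0 f x) | f <- maps] | x <- iota 0 q, y <- iota 0 q].

Definition separates_columns (n : nat) (ts : seq (seq nat)) : bool :=
  [&& size ts == n * n, all (fun t => all (fun j => nth 0 t j < n) (iota 0 6)) ts
    & all (fun jk => (jk.1 < jk.2) ==> uniq [seq (nth 0 t jk.1, nth 0 t jk.2) | t <- ts])
          [seq (j, k) | j <- iota 0 6, k <- iota 0 6]].

(** Counting again: n^2 distinct pairs in an n by n square exhaust it, so no list has to be compared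
    up to permutation by computation. *)
Lemma separates_columnsP n ts : separates_columns n ts -> transversal_design n ts.
Proof.
case/and3P => /eqP sz /allP lt_n /allP un; apply/allP => -[j k] jk; apply/implyP => lt_jk.
have /implyP/(_ lt_jk) u := un _ jk; have [hj hk] : j < 6 /\ k < 6.
  by case/allpairsP: jk => -[a b] [ha hb [-> ->]]; move: ha hb; rewrite !mem_iota.
have sub : {subset [seq (nth 0 t j, nth 0 t k) | t <- ts]
                <= [seq (a, b) | a <- iota 0 n, b <- iota 0 n]}.
  move=> _ /mapP[t /lt_n/allP h ->]; apply/allpairsP; exists (nth 0 t j, nth 0 t k).
  by rewrite !mem_iota /= !h ?mem_iota.
have [|_ e] := uniq_min_size u sub; first by rewrite size_allpairs !size_iota size_map sz.
by apply: uniq_perm => //; rewrite allpairs_uniq ?iota_uniq // => -[? ?] [? ?] _ _ [-> ->].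
Qed.

(** Multiplication by 0, 1, x, x + 1, x^2 modulo x^3 + x + 1 over GF(2). *)
Lemma transversal_design8 : transversal_design 8 (field_rows 8 2 3
  [:: [:: 0; 0; 0; 0; 0; 0; 0; 0];
      [:: 0; 1; 2; 3; 4; 5; 6; 7];
      [:: 0; 2; 4; 6; 3; 1; 7; 5];
      [:: 0; 3; 6; 5; 7; 4; 1; 2];
      [:: 0; 4; 3; 7; 6; 2; 5; 1]]).
Proof. by apply: separates_columnsP; vm_compute. Qed.

(** Multiplication by 0, 1, 2, x, x + 1 modulo x^2 + 1 over GF(3). *)
Lemma transversal_design9 : transversal_design 9 (field_rows 9 3 2
  [:: [:: 0; 0; 0; 0; 0; 0; 0; 0; 0];
      [:: 0; 1; 2; 3; 4; 5; 6; 7; 8];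
      [:: 0; 2; 1; 6; 8; 7; 3; 5; 4];
      [:: 0; 3; 6; 2; 5; 8; 1; 4; 7];
      [:: 0; 4; 8; 5; 6; 1; 7; 2; 3]]).
Proof. by apply: separates_columnsP; vm_compute. Qed.

(** Multiplication by 0, 1, x, x + 1, x^2 modulo x^4 + x + 1 over GF(2). *)
Lemma transversal_design16 : transversal_design 16 (field_rows 16 2 4
  [:: [:: 0; 0; 0; 0; 0; 0; 0; 0; 0; 0; 0; 0; 0; 0; 0; 0];
      [:: 0; 1; 2; 3; 4; 5; 6; 7; 8; 9; 10; 11; 12; 13; 14; 15];
      [:: 0; 2; 4; 6; 8; 10; 12; 14; 3; 1; 7; 5; 11; 9; 15; 13];
      [:: 0; 3; 6; 5; 12; 15; 10; 9; 11; 8; 13; 14; 7; 4; 1; 2];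
      [:: 0; 4; 8; 12; 3; 7; 11; 15; 6; 2; 14; 10; 5; 1; 13; 9]]).
Proof. by apply: separates_columnsP; vm_compute. Qed.

Definition td_order (n : nat) : bool := coprime n 6 || (n \in [:: 8; 9; 16]).

Lemma transversal_design_exists n : td_order n -> exists ts, transversal_design n ts.
Proof.
case/orP => [/transversal_design_coprime6 h|]; first by eexists; exact: h.
rewrite !inE => /or3P[] /eqP ->; eexists; [exact: transversal_design8 | exact: transversal_design9 |].
exact: transversal_design16.
Qed.

(** * Recursion on the order *)

(** Indexed by m/2. Repetition pads each nonempty list to three entries when fewer weights are
    available. *)
Definition weights (m : nat) : seq nat :=
  nth [::] [:: [::]; [:: 2; 2; 2]; [:: 2; 2; 4]; [:: 0; 6; 8]; [:: 0; 8; 8]; [:: 0; 4; 10]] m./2.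

Lemma good_weights m w : m \in [:: 2; 4; 6; 8; 10] -> w \in weights m ->
  good (multipartite (rcons (nseq 5 m) w)).
Proof.
have : all (fun m => all (fun w => rcons (nseq 5 m) w \in gdd_shapes) (weights m))
           [:: 2; 4; 6; 8; 10].
  by vm_compute.
by move=> /allP h /h/allP{}h /h/good_gdd.
Qed.

Definition last_group (m n a b : nat) : nat :=
  (n - a - b) * nth 0 (weights m) 0 + a * nth 0 (weights m) 1 + b * nth 0 (weights m) 2.

Lemma admissible_wilson m n a b : m \in [:: 2; 4; 6; 8; 10] -> td_order n -> a + b <= n ->
  admissible (n * m + 1) -> admissible (last_group m n a b + 1) ->
  admissible (5 * (n * m) + last_group m n a b + 1).
Proof.
move=> hm /transversal_design_exists[ts td] hab adm adl.
pose ws := nseq (n - a - b) (nth 0 (weights m) 0) ++ nseq a (nth 0 (weights m) 1)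
             ++ nseq b (nth 0 (weights m) 2).
have sw : size (weights m) = 3 by move: hm; rewrite !inE => /or4P[| | |/orP[]] /eqP ->.
have gws w : w \in ws -> good (multipartite (rcons (nseq 5 m) w)).
  move=> hw; apply: good_weights => //; move: hw.
  by rewrite !mem_cat !mem_nseq => /or3P[] /andP[_ /eqP ->]; rewrite mem_nth ?sw.
have sws : size ws = n by rewrite !size_cat !size_nseq; lia.
have ews : sumn ws = last_group m n a b.
  by rewrite !sumn_cat !sumn_nseq /last_group addnA ![_ * nth _ _ _]mulnC.
have := good_wilson td sws gws; rewrite ews => /(@good_fill _ 1 (leqnn 1)).
rewrite sumn_rcons sumn_nseq [_ * 5]mulnC; apply.
by case=> [|[|[|[|[|[|j]]]]]].
Qed.

Definition target (v : nat) : bool := (20 < v) && ((v %% 10 == 1) || (v %% 10 == 5)).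

(* Entry [i] concerns the order [v] with [v %/ 5 = i + 4]; it is [(0, 0, 0, 0)] when [v] is in
   [direct_orders]. *)
Definition route_order (i : nat) : nat := 5 * (i + 4) + ~~ odd i.

Definition check_route (v : nat) (r : nat * nat * nat * nat) : bool :=
  let: (m, n, a, b) := r in
  let s := last_group m n a b in
  (v \in direct_orders) ||
  [&& m \in [:: 2; 4; 6; 8; 10], 0 < n, td_order n, a + b <= n, v == 5 * (n * m) + s + 1,
      target (n * m + 1) & (s == 0) || target (s + 1)].

Lemma routesP :
  all (fun i => check_route (route_order i) (nth (0, 0, 0, 0) routes i)) (iota 0 (size routes)).
Proof. by vm_compute. Qed.

Lemma admissible_route v : target v -> v < 1171 ->
  (forall u, u < v -> target u -> admissible u) -> admissible v.
Proof.
move=> tv v_lt IH; have hi : v %/ 5 - 4 \in iota 0 (size routes).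
  by rewrite mem_iota -[size routes]/230; move: tv v_lt; rewrite /target; lia.
have := allP routesP _ hi; have -> : route_order (v %/ 5 - 4) = v.
  by move: tv; rewrite /target /route_order; lia.
case: nth => [[[m n] a] b] /orP[/admissible_direct //|].
case/and5P => hm n0 htd hab /and3P[/eqP ev tm ts]; rewrite ev in IH *.
have m0 : 0 < m by move: hm; rewrite !inE; lia.
apply: admissible_wilson => //; first by apply: IH => //; nia.
(* An empty last group leaves only the point at infinity, a design of order 1. *)
by case/orP: ts => [/eqP ->|ts]; [apply: admissible1 | apply: IH => //; nia].
Qed.

(* The group size [n] is chosen prime to 6 so that [v = 50 n + h] with [21 <= h <= 220]. *)
Lemma admissible_large v : target v -> 1171 <= v ->
  (forall u, u < v -> target u -> admissible u) -> admissible v.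
Proof.
move=> tv v_ge IH; pose k := (v - 21) %/ 50.
(* The table holds the distance from [k] down to the nearest number that is 1 or 5 modulo 6. *)
pose n := k - nth 0 [:: 1; 0; 1; 2; 3; 0] (k %% 6).
have [n6 nk] : coprime n 6 /\ (k - 3 <= n <= k).
  have r6 : k %% 6 < 6 by rewrite ltn_mod.
  have k23 : 23 <= k by rewrite /k leq_divRL //; lia.
  suff [n1 nk] : (n %% 6 == 1) || (n %% 6 == 5) /\ (k - 3 <= n <= k).
    by split=> //; rewrite -coprime_modl; case/orP: n1 => /eqP ->.
  move: r6; case e: (k %% 6) => [|[|[|[|[|[|]]]]]] // _; rewrite /n e /=; lia.
(* [s] is 0 or 4 modulo 10, so at most one weight 4 is used and the rest of [s] is made of tens. *)
pose s := v - 50 * n - 1; pose a : nat := v %% 10 == 5; pose b := (s - 4 * a) %/ 10.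
have hk : 50 * k + 21 <= v < 50 * k + 71 by rewrite /k; lia.
have es : last_group 10 n a b = s.
  by move: tv; rewrite /last_group /target /b /a /s /=; lia.
have ev : v = 5 * (n * 10) + last_group 10 n a b + 1 by rewrite es /s; lia.
(* Since [s] is at most 214, at most 22 points of the last group get a positive weight. The bound
   1171 = 50 * 23 + 21 is where [k] reaches 23, from which point [n] is at least 23. *)
have n_ge : 23 <= n.
  case: (leqP 26 k) => [|k26]; first by lia.
  by rewrite /n; have [->|[->|->]] : k = 23 \/ k = 24 \/ k = 25 by lia.
rewrite ev; apply: admissible_wilson => //; first by rewrite /td_order n6.
- by rewrite /b /a /s; lia.
- by apply: IH; rewrite /target; lia.
- by apply: IH; move: tv; rewrite es /target /s; lia.
Qed.

Lemma admissible_target v : target v -> admissible v.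
Proof.
elim/ltn_ind: v => v IH tv; case: (ltnP v 1171) => h; first exact: admissible_route.
exact: admissible_large.
Qed.

(** * Defining sets *)

Import GRing.Theory Num.Theory Order.TTheory.

Lemma subseq2_asym (T : eqType) (x y : T) (s : seq T) :
  uniq s -> x != y -> subseq [:: x; y] s -> ~~ subseq [:: y; x] s.
Proof.
move=> + xy; elim: s => //= z s IH /andP[zNs us].
have yx : (y == x) = false by rewrite eq_sym (negbTE xy).
case: (eqVneq x z) zNs => [<-|xz] zNs.
  by rewrite yx => _; apply: contra zNs => /subseq2_mem/andP[].
case: (eqVneq y z) zNs => [<- yNs /subseq2_mem/andP[_ ys]|_ _]; last exact: IH.
by rewrite ys in yNs.
Qed.

(** The reason for trading adjacent entries: nothing stands between them, so the swap changes the
    order of no other pair. *)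
Lemma subseq2_swap (T : eqType) (x y u v : T) (s1 s2 : seq T) :
  (u, v) != (x, y) -> (u, v) != (y, x) ->
  subseq [:: u; v] (s1 ++ [:: y, x & s2]) = subseq [:: u; v] (s1 ++ [:: x, y & s2]).
Proof.
move=> n1 n2; elim: s1 => [|z s1 IH] /=; last first.
  by case: (u == z) => //; rewrite !sub1seq !mem_cat !inE; congr (_ || _); rewrite orbCA.
move: n1 n2; rewrite !xpair_eqE.
case: (eqVneq x y) => [->//|xy] /=; have yx : (y == x) = false by rewrite eq_sym (negbTE xy).
case: (eqVneq u x) => [->|ux] /=; rewrite ?(negbTE xy) /=.
  by rewrite eqxx => /negbTE ->.
case: (eqVneq u y) => [uy|uy] /=; last by rewrite (negbTE ux).
by move=> _ /negbTE ->.
Qed.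

Section Trades.
Variables (V : finType) (B : {set 5.-tuple V}).
Hypotheses (dB : directed_design B) (sB : super_simple B).

Lemma directed_uniq b : b \in B -> uniq b.
Proof. by case/andP: dB => /forallP/(_ b) /implyP. Qed.

Lemma directed_unique b c u v : u != v -> b \in B -> c \in B ->
  subseq [:: u; v] b -> subseq [:: u; v] c -> b = c.
Proof.
move=> uv bB cB ub uc; case/andP: dB => _ /forallP/(_ u)/forallP/(_ v)/implyP/(_ uv)/cards1P[t /setP et].
have := et b; have := et c; rewrite !inE bB cB ub uc => /esym/eqP -> /esym/eqP ->.
by [].
Qed.

(** If [S] missed both blocks, it would also lie in the design obtained by swapping [x] and [y] in
    each, and would not determine [B]. *)
Lemma trade_defining (S : {set 5.-tuple V}) b c x y : defining_set B S ->
  b \in B -> c \in B -> infix [:: x; y] b -> infix [:: y; x] c -> (b \in S) || (c \in S).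
Proof.
move=> /andP[SB /forallP defS] bB cB xyb yxc; apply/negPn/negP; rewrite negb_or => /andP[bS cS].
have [ub uc] := (directed_uniq bB, directed_uniq cB).
have [s1 [s2 eb]] := infixP xyb; have [t1 [t2 ec]] := infixP yxc.
have xy : x != y.
  by move: ub; rewrite eb cat_uniq => /and3P[_ _ /=]; rewrite inE negb_or -andbA => /andP[].
have yx : y != x by rewrite eq_sym.
have sb : size (s1 ++ [:: y, x & s2]) == 5 by rewrite -(size_tuple b) eb !size_cat.
have sc : size (t1 ++ [:: x, y & t2]) == 5 by rewrite -(size_tuple c) ec !size_cat.
pose b' := Tuple sb; pose c' := Tuple sc.
pose phi t := if t == b then b' else if t == c then c' else t.
have subxy : subseq [:: x; y] b by apply: infixW.
have subyx : subseq [:: y; x] c by apply: infixW.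
have bc : b != c.
  by apply: contraTneq subxy => ->; apply: subseq2_asym subyx.
have pb : perm_eq b' b by rewrite /= eb perm_cat2l /= (perm_catCA [:: y] [:: x]).
have pc : perm_eq c' c by rewrite /= ec perm_cat2l /= (perm_catCA [:: x] [:: y]).
have ub' : uniq b' by rewrite (perm_uniq pb).
have uc' : uniq c' by rewrite (perm_uniq pc).
have subyx' : subseq [:: y; x] b'.
  by apply: infixW; apply/infixP; exists s1, s2.
have subxy' : subseq [:: x; y] c'.
  by apply: infixW; apply/infixP; exists t1, t2.
(* On ordered pairs the trade only exchanges [(x, y)] and [(y, x)]: the block covering a pair
   afterwards is the image of the one that covered its [sw] before. *)
pose sw (p : V * V) := if (p == (x, y)) || (p == (y, x)) then (p.2, p.1) else p.
have phiE t u v : t \in B -> u != v ->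
    subseq [:: u; v] (phi t) = subseq [:: (sw (u, v)).1; (sw (u, v)).2] t.
  move=> tB uv; rewrite /phi /sw.
  case: (eqVneq (u, v) (x, y)) => [[-> ->]|n1] /=.
    case: (eqVneq t b) => [->|tb].
      by rewrite (negbTE (subseq2_asym ub' yx subyx')) (negbTE (subseq2_asym ub xy subxy)).
    case: (eqVneq t c) => [->|tc]; first by rewrite subxy' subyx.
    transitivity false; first by apply: contraNF tb => h; apply/eqP; apply: directed_unique xy _ _ h subxy.
    by symmetry; apply: contraNF tc => h; apply/eqP; apply: directed_unique yx _ _ h subyx.
  case: (eqVneq (u, v) (y, x)) => [[-> ->]|n2] /=.
    case: (eqVneq t b) => [->|tb]; first by rewrite subyx' subxy.
    case: (eqVneq t c) => [->|tc].
      by rewrite (negbTE (subseq2_asym uc' xy subxy')) (negbTE (subseq2_asym uc yx subyx)).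
    transitivity false; first by apply: contraNF tc => h; apply/eqP; apply: directed_unique yx _ _ h subyx.
    by symmetry; apply: contraNF tb => h; apply/eqP; apply: directed_unique xy _ _ h subxy.
  case: (eqVneq t b) => [->|_]; first by rewrite eb /= subseq2_swap.
  by case: (eqVneq t c) => [->|_] //; rewrite ec /= subseq2_swap.
have dphi : directed_design (phi @: B).
  apply/andP; split.
    apply/forallP => t; apply/implyP => /imsetP[s sB' ->]; rewrite /phi.
    by do 2!case: ifP => // _; apply: directed_uniq.
  apply/forallP => u; apply/forallP => v; apply/implyP => uv.
  have -> : [set t in phi @: B | subseq [:: u; v] t] =
      phi @: [set t in B | subseq [:: (sw (u, v)).1; (sw (u, v)).2] t].
    apply/setP => t; rewrite !inE; apply/andP/imsetP => [[/imsetP[s sB' ->] h]|[s]].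
      by exists s; rewrite // inE sB' -phiE //.
    by rewrite inE => /andP[sB' h] ->; rewrite imset_f // phiE //.
  have uv' : (sw (u, v)).1 != (sw (u, v)).2 by rewrite /sw; case: ifP => _ //=; rewrite eq_sym.
  case/andP: dB => _ /forallP/(_ (sw (u, v)).1)/forallP/(_ (sw (u, v)).2)/implyP/(_ uv')/cards1P[t ->].
  by rewrite imset_set1 cards1.
have Sphi : S \subset phi @: B.
  apply/subsetP => t tS; apply/imsetP; exists t; first exact: (subsetP SB).
  by rewrite /phi; case: eqP => [e|_]; [rewrite -e tS in bS|case: eqP => // e; rewrite -e tS in cS].
(* Then [b'] would be a block of [B] distinct from [b] with the same five points, against
   super-simplicity. *)
have /eqP ephi : phi @: B == B by have := defS (phi @: B); rewrite dphi Sphi.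
have b'B : b' \in B by rewrite -ephi; apply/imsetP; exists b; rewrite // /phi eqxx.
have bb' : b != b' by apply: contraTneq subxy => ->; apply: subseq2_asym subyx'.
move/forallP: sB => /(_ b); rewrite bB => /forallP/(_ b'); rewrite b'B bb' /=.
have -> : [set x in b'] = [set x in b] by apply/setP => z; rewrite !inE (perm_mem pb).
by rewrite setIid cardsE (card_uniqP ub) size_tuple.
Qed.

End Trades.

(** * From decompositions to designs, and the bound on defining sets *)

Theorem admissible_half (v : nat) : 1 < v -> admissible v ->
  exists B : {set 5.-tuple 'I_v},
    [/\ directed_design B, super_simple B & (1 / 2 <= f B)%R].
Proof.
move=> v1 av.
have := good_complete (enum_uniq 'I_v) (size_enum_ord v) av.
move=> [Bs [Bs' [hs hc hm hp hw]]].
have cov x y : count (subseq [:: x; y]) Bs = (x != y).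
  by rewrite hc !mem_enum !inE !andbT.
(* A repeated block would cover the ordered pair of its first two points twice. *)
have uBs : uniq Bs.
  apply/count_mem_uniq => b; case bB: (b \in Bs); last exact/count_memPn/negbT.
  apply/eqP; rewrite eqn_leq -has_count has_pred1 bB andbT.
  have /andP[ub sb] := hs _ bB; case: b sb ub bB => [|x [|y b]] // _ _ bB.
  apply: leq_trans (_ : (x != y : nat) <= 1); last exact: leq_b1.
  rewrite -cov; apply: sub_count => c /eqP ->.
  by rewrite /= !eqxx sub0seq.
pose B : {set 5.-tuple 'I_v} := [set t | tval t \in Bs].
have cardE' (a : pred (seq 'I_v)) : #|[set t in B | a t]| = count a Bs.
  rewrite -size_filter cardE -(size_map val); apply: perm_size; apply: uniq_perm.
  - by rewrite (map_inj_uniq val_inj) enum_uniq.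
  - exact: filter_uniq.
  move=> s; rewrite mem_filter; apply/mapP/andP => [[t]|[sa sB]].
    by rewrite mem_enum !inE => /andP[? ?] ->.
  have /andP[_ ss] := hs _ sB.
  by exists (Tuple ss); rewrite // mem_enum !inE /= sB.
have dB : directed_design B.
  apply/andP; split.
    by apply/forallP => t; apply/implyP; rewrite inE => /hs/andP[].
  apply/forallP => x; apply/forallP => y; apply/implyP => xy.
  by rewrite (cardE' (subseq [:: x; y])) cov xy.
have sB : super_simple B.
  apply/forallP => b; apply/implyP; rewrite inE => bB; apply/forallP => c; apply/implyP.
  rewrite inE => cB; apply/implyP => bc.
  apply: leq_trans (hm _ _ bB cB bc).
  have -> : [set x in tval b] :&: [set x in tval c] = [set x in [seq x <- b | x \in tval c]].
    by apply/setP => x; rewrite !inE mem_filter andbC.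
  by rewrite cardsE card_size.
exists B; split=> //.
have defS : defining_set B (smallest_defining_set B).
  by rewrite /smallest_defining_set; case: arg_minnP => //; apply: defining_set_refl.
rewrite /f; set S := smallest_defining_set B in defS *.
have SB : S \subset B by case/andP: defS.
pose inS (s : seq 'I_v) := s \in map val (enum S).
have inSE (t : 5.-tuple 'I_v) : inS t = (t \in S) by rewrite /inS (mem_map val_inj) mem_enum.
have cS : count inS Bs = #|S|.
  rewrite -cardE'; apply: eq_card => t; rewrite inE inSE.
  by apply: andb_idl => tS; apply: (subsetP SB).
(* Each position pairs a block with its partner, and one of the two is in [S]. The statement
   concerns arbitrary matched lists so that induction applies; for [Bs] and [Bs'] both counts are
   the size of [S]. *)
have hit s s' : all2 (@swappable _) s s' -> {subset s <= Bs} -> {subset s' <= Bs} ->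
    size s <= count inS s' + count inS s.
  elim: s s' => [|b s IH] [|c s'] //= /andP[/swappableP[x [y /andP[xy yx]]] w] hB hB'.
  have bB : b \in Bs by apply: hB; rewrite inE eqxx.
  have cB : c \in Bs by apply: hB'; rewrite inE eqxx.
  have /andP[_ sb] := hs _ bB; have /andP[_ sc] := hs _ cB.
  have bc : inS b || inS c.
    rewrite (inSE (Tuple sb)) (inSE (Tuple sc)).
    by apply: (trade_defining (b := Tuple sb) (c := Tuple sc) dB sB defS _ _ xy yx); rewrite inE.
  have {}IH : size s <= count inS s' + count inS s.
    by apply: IH w _ _ => z zs; [apply: hB|apply: hB']; rewrite inE zs orbT.
  by rewrite addnACA -[(size s).+1]add1n leq_add //; case: (inS b) bc; case: (inS c).
have half : #|B| <= #|S| + #|S|.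
  have -> : #|B| = size Bs.
    by rewrite -(count_predT Bs) -cardE'; apply: eq_card => t; rewrite !inE andbT.
  by rewrite -{1}cS -(permP hp) -cS; apply: hit hw _ _ => // b; rewrite (perm_mem hp).
(* Two points exist because [1 < v], so some block covers them and the quotient [f B] has a nonzero
   denominator. *)
have B0 : (0 < #|B|)%N.
  have : 0 < count (subseq [:: Ordinal (ltnW v1); Ordinal v1]) Bs by rewrite cov.
  rewrite -cardE' => h; apply: leq_trans h _.
  by apply/subset_leq_card/subsetP => t; rewrite inE => /andP[].
rewrite ler_pdivlMr ?ltr0n // mulrC mulrA mulr1 ler_pdivrMr ?ltr0n //.
by rewrite -natrM ler_nat muln2 -addnn.
Qed.

Theorem theorem3p5 (v : nat)
    (hv_gt1 : 1 < v)
    (hv_mod : v %% 10 = 1 \/ v %% 10 = 5)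
    (hv_exc : v \notin [:: 5; 15; 11; 91]) :
  exists B : {set 5.-tuple 'I_v},
    [/\ directed_design B, super_simple B & (1 / 2 <= f B)%R].
Proof.
apply: admissible_half => //; apply: admissible_target.
by move: hv_exc; rewrite /target !inE; lia.
Qed.
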